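(* In the interactive effects panel model described in the context (with $T,K,q,m$ fixed, $1\le q<T$), assume that $\boldsymbol{\Phi}_{01}$ is nonsingular and that: (A1) the vectors $\boldsymbol{v}_i := (\boldsymbol{z}_i',\boldsymbol{a}_i',\boldsymbol{\epsilon}_i')'$ $(i=1,\ldots,n)$ are independently and identically distributed; (A2) the entries in $\boldsymbol{v}_i$ have finite second moments; (A3) $E(\boldsymbol{z}_1\boldsymbol{\epsilon}_1')=\boldsymbol{0}$; (A4) $\mathrm{Var}(\boldsymbol{z}_1)$ is positive definite; (A5) for each $\boldsymbol{\psi}\in\boldsymbol{\Psi}$ with $\boldsymbol{\psi}\neq\boldsymbol{\psi}_0$ there is at least one $t\in\{1,\ldots,T\}$ such that $\boldsymbol{\pi}_t(\boldsymbol{\psi})\neq\boldsymbol{\pi}_t(\boldsymbol{\psi}_0)$. Let $\overline{\boldsymbol{\Psi}}$ be a compact subset of $\boldsymbol{\Psi}$ with $\boldsymbol{\psi}_0$ in its interior. Then there is a measurable minimizer $\widehat{\boldsymbol{\psi}}$ of $S_n(\cdot)$ in $\overline{\boldsymbol{\Psi}}$ such that $\widehat{\boldsymbol{\psi}}\rightarrow_p\boldsymbol{\psi}_0$ as $n\to\infty$ with $T$ fixed.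
   Context: Model. For individuals $i=1,\ldots,n$ and periods $t=1,\ldots,T$, $$\boldsymbol{y}_i=\boldsymbol{X}_i\boldsymbol{\beta}_0+\boldsymbol{\delta}_0+\boldsymbol{\Phi}_0\widetilde{\boldsymbol{\eta}}_i+\boldsymbol{\epsilon}_i,$$ where $\boldsymbol{y}_i=(y_{i1},\ldots,y_{iT})'$ is $T\times1$, $\boldsymbol{X}_i$ is the $T\times K$ random matrix with $t$th row $\boldsymbol{x}_{it}'$, $\boldsymbol{\beta}_0\in\mathbb{R}^K$ and $\boldsymbol{\delta}_0\in\mathbb{R}^T$ are fixed parameters, $\boldsymbol{\Phi}_0$ is a fixed $T\times q$ matrix with rows $\boldsymbol{\phi}_{0t}'$, $\widetilde{\boldsymbol{\eta}}_i$ is a $q\times1$ unobserved random vector with $E(\widetilde{\boldsymbol{\eta}}_i)=\boldsymbol{0}$, and $\boldsymbol{\epsilon}_i=(\epsilon_{i1},\ldots,\epsilon_{iT})'$ is an unobserved error vector. Standing assumption: $E(\epsilon_{it}\mid\boldsymbol{x}_{it},\delta_{0t},\boldsymbol{\phi}_{0t}'\widetilde{\boldsymbol{\eta}}_i)=0$ (so $E(\boldsymbol{\epsilon}_i)=\boldsymbol{0}$). Normalization. $1\le q<T$. $\boldsymbol{\Phi}_{01}$ and $\boldsymbol{\Phi}_{02}$ are the first $q$ and last $T-q$ rows of $\boldsymbol{\Phi}_0$. With $\boldsymbol{\Phi}_{01}$ nonsingular, $\boldsymbol{\eta}_i:=\boldsymbol{\Phi}_{01}\widetilde{\boldsymbol{\eta}}_i$,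 $\boldsymbol{\Lambda}_{02}:=\boldsymbol{\Phi}_{02}\boldsymbol{\Phi}_{01}^{-1}$, $\boldsymbol{\Lambda}_0':=(\boldsymbol{I}_q,\boldsymbol{\Lambda}_{02}')$, so $\boldsymbol{\Lambda}_0\boldsymbol{\eta}_i=\boldsymbol{\Phi}_0\widetilde{\boldsymbol{\eta}}_i$. Projection. $\boldsymbol{z}_i$ is the $m\times1$ vector of all distinct entries of $(\boldsymbol{x}_{i1}',\ldots,\boldsymbol{x}_{iT}')'$ (with further entries removed, if needed, until $E(\boldsymbol{z}_i\boldsymbol{z}_i')$ has full rank). Thus for each $t$ there is a constant $m\times K$ matrix $\boldsymbol{S}_t$ (a 0/1 selection matrix when every entry of $\boldsymbol{x}_{it}$ is an entry of $\boldsymbol{z}_i$) such that, after subtracting means from both sides, $\boldsymbol{x}_{it}$ equals $\boldsymbol{S}_t'\boldsymbol{z}_i$. The linear projection of the $j$th entry of $\boldsymbol{\eta}_i$ on $1$ and $\boldsymbol{z}_i$ is $\eta_{ij}=\mu_{0j}+\boldsymbol{z}_i'\boldsymbol{\theta}_{0j}+a_{ij}$, with $\boldsymbol{\theta}_{0j}=\mathrm{Var}(\boldsymbol{z}_i)^{-1}\mathrm{Cov}(\boldsymbol{z}_i,\eta_{ij})$ and $\mu_{0j}=-E(\boldsymbol{z}_i')\boldsymbol{\theta}_{0j}$; so $a_{ij}$ has mean zero and is uncorrelated with $\boldsymbol{z}_i$. Put $\boldsymbol{a}_i=(a_{i1},\ldots,a_{iq})'$, $\boldsymbol{\Theta}_0=(\boldsymbol{\theta}_{01},\ldots,\boldsymbol{\theta}_{0q})$,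 $\boldsymbol{\theta}_0=\mathrm{vec}(\boldsymbol{\Theta}_0)$, $\boldsymbol{\lambda}_0=\mathrm{vec}(\boldsymbol{\Lambda}_{02})$, $\boldsymbol{\psi}_0=(\boldsymbol{\beta}_0',\boldsymbol{\theta}_0',\boldsymbol{\lambda}_0')'$, $\boldsymbol{Z}_i=\boldsymbol{I}_q\otimes\boldsymbol{z}_i'$. Parameters and objective. A generic parameter is $\boldsymbol{\psi}=(\boldsymbol{\beta}',\boldsymbol{\theta}',\boldsymbol{\lambda}')'\in\boldsymbol{\Psi}\subseteq\mathbb{R}^p$, $p=K+q(m+T-q)$, where $\boldsymbol{\beta}$ is $K\times 1$, $\boldsymbol{\theta}=\mathrm{vec}(\boldsymbol{\Theta})$ with $\boldsymbol{\Theta}$ of size $m\times q$, $\boldsymbol{\lambda}=\mathrm{vec}(\boldsymbol{\Lambda}_2)$ with $\boldsymbol{\Lambda}_2$ of size $(T-q)\times q$, and $\boldsymbol{\Lambda}'=(\boldsymbol{I}_q,\boldsymbol{\Lambda}_2')$; $\boldsymbol{\psi}_0\in\boldsymbol{\Psi}$. A dot denotes cross-sectional demeaning, e.g. $\dot{\boldsymbol{X}}_i=\boldsymbol{X}_i-\frac1n\sum_{j=1}^n\boldsymbol{X}_j$, and likewise $\dot{\boldsymbol{y}}_i,\dot{\boldsymbol{Z}}_i,\dot{\boldsymbol{z}}_i$. The nonlinear least squares objective is $$S_n(\boldsymbol{\psi})=\frac1{2n}\sum_{i=1}^n(\dot{\boldsymbol{y}}_i-\dot{\boldsymbol{X}}_i\boldsymbol{\beta}-\boldsymbol{\Lambda}\dot{\boldsymbol{Z}}_i\boldsymbol{\theta})'(\dot{\boldsymbol{y}}_i-\dot{\boldsymbol{X}}_i\boldsymbol{\beta}-\boldsymbol{\Lambda}\dot{\boldsymbol{Z}}_i\boldsymbol{\theta})=\frac1{2n}\sum_{i=1}^n\sum_{t=1}^T\left(\dot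 y_{it}-\dot{\boldsymbol{z}}_i'\boldsymbol{\pi}_t(\boldsymbol{\psi})\right)^2,$$ where $\boldsymbol{\pi}_t(\boldsymbol{\psi}):=\boldsymbol{S}_t\boldsymbol{\beta}+\boldsymbol{\Theta}\boldsymbol{\ell}_t\in\mathbb{R}^m$ and $\boldsymbol{\ell}_t'$ is the $t$th row of $\boldsymbol{\Lambda}$. *)

(* Defs.v *)
From HB Require Import structures.
From mathcomp Require Import all_boot all_order all_algebra.
From mathcomp Require Import all_classical all_reals all_analysis.
From mathcomp Require Import mxtens.

Set Implicit Arguments.
Unset Strict Implicit.
Unset Printing Implicit Defensive.

Import Order.TTheory GRing.Theory Num.Theory.
Import numFieldNormedType.Exports.

Local Open Scope classical_set_scope.
Local Open Scope ring_scope.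

(* The number of periods is T = q + r with q, r > 0, so that the first q and
   the last T - q = r rows are [usubmx] and [dsubmx].  Individuals are indexed
   by [nat] starting at 0; the sample of size n consists of those i < n. *)

Section RandomMatrices.
Context {d : measure_display} {Omega : measurableType d} {R : realType}.
Variable P : probability Omega R.

Definition random_mx m n (A : Omega -> 'M[R]_(m, n)) : Prop :=
  forall i j, measurable_fun [set: Omega] (fun w => A w i j).

(* Borel sets of R^k, as the sigma-algebra generated by the coordinates. *)
Definition borel_cV k : set (set 'cV[R]_k) :=
  g_sigma_preimage (fun (i : 'I_k) (v : 'cV[R]_k) => v i 0).

(* [fine] sends infinite expectations to 0; an undefined one is -oo by the
   convention +oo - oo = -oo. *)
Definition Emx m n (A : Omega -> 'M[R]_(m, n)) : 'M[R]_(m, n) :=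
  \matrix_(i, j) fine 'E_P[fun w => A w i j].

Definition Cov k l (U : Omega -> 'cV[R]_k) (V : Omega -> 'cV[R]_l) :
    'M[R]_(k, l) :=
  \matrix_(i, j) fine (covariance P (fun w => U w i 0) (fun w => V w j 0)).

Definition Var k (U : Omega -> 'cV[R]_k) : 'M[R]_k := Cov U U.

Definition mutually_independent k (V : nat -> Omega -> 'cV[R]_k) : Prop :=
  forall (J : seq nat) (B : nat -> set 'cV[R]_k),
    uniq J -> (forall i, borel_cV (B i)) ->
    P (\bigcap_(i in [set` J]) (V i @^-1` B i)) =
    (\prod_(i <- J) P (V i @^-1` B i))%E.

Definition identically_distributed k (V : nat -> Omega -> 'cV[R]_k) : Prop :=
  forall i j (B : set 'cV[R]_k), borel_cV B ->
    P (V i @^-1` B) = P (V j @^-1` B).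

Definition iid k (V : nat -> Omega -> 'cV[R]_k) : Prop :=
  [/\ forall i, random_mx (V i), mutually_independent V
    & identically_distributed V].

(* E(e | W) = g(W) almost surely. *)
Definition is_cond_expectation k (e : Omega -> R) (W : Omega -> 'cV[R]_k)
    (g : 'cV[R]_k -> R) : Prop :=
  [/\ e \in Lfun P 1, g \o W \in Lfun P 1,
      forall A : set R, measurable A -> borel_cV (g @^-1` A)
    & forall B, borel_cV B ->
        (\int[P]_(w in W @^-1` B) (e w)%:E =
         \int[P]_(w in W @^-1` B) (g (W w))%:E)%E].

Definition enorm k (v : 'cV[R]_k) : R := Num.sqrt (\sum_i v i 0 ^+ 2).

Definition cvg_in_probability k (Y : nat -> Omega -> 'cV[R]_k)
    (c : 'cV[R]_k) : Prop :=
  forall e : R, 0 < e ->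
    P [set w | e < enorm (Y n w - c)] @[n --> \oo] --> 0%E.

End RandomMatrices.

Section Algebra.
Context {R : realType}.

Definition posdef k (A : 'M[R]_k) : Prop :=
  A^T = A /\ forall c : 'cV[R]_k, c != 0 -> 0 < (c^T *m A *m c) 0 0.

(* [mxvec] reads matrices row by row, whereas vec stacks columns. *)
Definition vec k l (A : 'M[R]_(k, l)) : 'cV[R]_(l * k) := (mxvec A^T)^T.
Definition unvec k l (v : 'cV[R]_(l * k)) : 'M[R]_(k, l) := (vec_mx v^T)^T.

(* The Kronecker product of I_q and z'; the cast identifies q * 1 with q. *)
Definition Zmx q m (z : 'cV[R]_m) : 'M[R]_(q, q * m) :=
  castmx (muln1 q, erefl (q * m)%N) (tensmx (1%:M : 'M[R]_q) z^T).

Definition demean k l (n : nat) (A : nat -> 'M[R]_(k, l)) (i : nat) :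
    'M[R]_(k, l) :=
  A i - n%:R^-1 *: \sum_(j < n) A j.

Definition Lambda q r (L2 : 'M[R]_(r, q)) : 'M[R]_(q + r, q) :=
  col_mx 1%:M L2.

Section Objective.
Variables K m q r : nat.
Implicit Type psi : 'cV[R]_(K + (q * m + q * r)).

Definition pack (beta : 'cV[R]_K) (Theta : 'M[R]_(m, q))
    (L2 : 'M[R]_(r, q)) : 'cV[R]_(K + (q * m + q * r)) :=
  col_mx beta (col_mx (vec Theta) (vec L2)).

Definition beta_of psi : 'cV[R]_K := usubmx psi.
Definition theta_of psi : 'cV[R]_(q * m) := usubmx (dsubmx psi).
Definition Theta_of psi : 'M[R]_(m, q) := unvec (theta_of psi).
Definition Lambda_of psi : 'M[R]_(q + r, q) :=
  Lambda (unvec (dsubmx (dsubmx psi))).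

Definition pi_t (Sm : 'I_(q + r) -> 'M[R]_(m, K)) (t : 'I_(q + r)) psi :
    'cV[R]_m :=
  Sm t *m beta_of psi + Theta_of psi *m (row t (Lambda_of psi))^T.

Definition nls (n : nat) (y : nat -> 'cV[R]_(q + r))
    (X : nat -> 'M[R]_(q + r, K)) (z : nat -> 'cV[R]_m) psi : R :=
  (2 * n%:R)^-1 * \sum_(i < n)
    let u := demean n y i - demean n X i *m beta_of psi
             - Lambda_of psi *m demean n (fun j => Zmx q (z j)) i
                 *m theta_of psi in
    (u^T *m u) 0 0.

End Objective.
End Algebra.

Section Model.
Context {d : measure_display} {Omega : measurableType d} {R : realType}.
Variable P : probability Omega R.
Variables K m q r : nat.

Definition outcome (beta0 : 'cV[R]_K) (delta0 : 'cV[R]_(q + r))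
    (Phi0 : 'M[R]_(q + r, q)) (X : nat -> Omega -> 'M[R]_(q + r, K))
    (etat : nat -> Omega -> 'cV[R]_q) (eps : nat -> Omega -> 'cV[R]_(q + r))
    (i : nat) (w : Omega) : 'cV[R]_(q + r) :=
  X i w *m beta0 + delta0 + Phi0 *m etat i w + eps i w.

(* E(eps_it | x_it, delta_t, phi_t' etat_i) = 0 *)
Definition errors_cond_mean_zero (delta0 : 'cV[R]_(q + r))
    (Phi0 : 'M[R]_(q + r, q)) (X : nat -> Omega -> 'M[R]_(q + r, K))
    (etat : nat -> Omega -> 'cV[R]_q)
    (eps : nat -> Omega -> 'cV[R]_(q + r)) : Prop :=
  forall i t,
    is_cond_expectation P (fun w => eps i w t 0)
      (fun w => col_mx (row t (X i w))^T
                  (col_mx (row t delta0) (row t Phi0 *m etat i w)))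
      (fun=> 0).

(* z_i lists the entries of X_i selected by sel, i.e. z_ik = x_{i,t,j} for
   (t, j) = sel k. *)
Definition selected (sel : 'I_m -> 'I_(q + r) * 'I_K)
    (X : nat -> Omega -> 'M[R]_(q + r, K)) (i : nat) (w : Omega) : 'cV[R]_m :=
  \col_k X i w (sel k).1 (sel k).2.

Definition spans_regressors (Sm : 'I_(q + r) -> 'M[R]_(m, K))
    (X : nat -> Omega -> 'M[R]_(q + r, K)) (z : nat -> Omega -> 'cV[R]_m) :
    Prop :=
  forall i t, {ae P, forall w,
    (row t (X i w))^T - Emx P (fun w' => (row t (X i w'))^T) =
    (Sm t)^T *m (z i w - Emx P (z i))}.

Definition proj_slope (z : Omega -> 'cV[R]_m) (eta : Omega -> 'cV[R]_q) :
    'M[R]_(m, q) :=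
  invmx (Var P z) *m Cov P z eta.

Definition proj_intercept (z : Omega -> 'cV[R]_m) (eta : Omega -> 'cV[R]_q) :
    'cV[R]_q :=
  - ((proj_slope z eta)^T *m Emx P z).

End Model.

(* Main.v *)
Require Import Defs.
From HB Require Import structures.
From mathcomp Require Import all_boot all_order all_algebra.
From mathcomp Require Import all_classical all_reals all_analysis.
From mathcomp Require Import measurable_realfun.
From mathcomp Require mxtens.
From mathcomp Require Import ring lra.

Set Implicit Arguments.
Unset Strict Implicit.
Unset Printing Implicit Defensive.

Import Order.TTheory GRing.Theory Num.Theory.
Import numFieldNormedType.Exports.

Local Open Scope classical_set_scope.
Local Open Scope ring_scope.

(* Identification plus uniform control of the objective.  Up to a constant in
   i, the residual of psi in period t is
     sum_j (beta0_j - beta_j) c_tj(i) + b_t' (z_i - E z) + u_it,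
   where b_t = pi_t(psi0) - pi_t(psi), u_it = l_0t' a_i + eps_it is centered and
   uncorrelated with z_i, and c_tj(i) is the part of x_itj not explained by z_i.
   The latter is deterministic, but nothing forces it to be constant, or even
   bounded, in i.  Hence 2 (S_n(psi) - S_n(psi0)) is a sum over t of a quadratic
   form in b_t whose matrix tends to Var(z) by the weak law, of terms linear in
   b_t with coefficients tending to 0, and of |h|^2 + 2 <h, e> with h in the span
   of the K demeaned vectors c_tj.  Completing the square in an orthonormal frame
   o_l of that span bounds the last part below by - sum_l <o_l, e>^2, which is
   O(1/n) in probability whatever the size of c.  So a minimizer satisfies
   sum_t b_t' Var(z) b_t <= o_p(1), and by identification and compactness the
   left-hand side is bounded below away from psi0.

   The minimizer is made measurable by lexicographic minimization of the
   coordinates over the random compact set of minimizers.  The weak law for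
   integrable variables follows from Chebyshev's inequality by truncation. *)

(** * Measurable minimizers *)

Lemma compact_argmin (T : topologicalType) (R : realType) (f : T -> R)
    (A : set T) :
  A !=set0 -> compact A -> continuous f ->
  exists2 c, A c & forall x, A x -> f c <= f x.
Proof.
move=> A0 cA cf.
have [c /set_mem Ac cmin] :=
  compact_EVT_min A0 cA (continuous_subspaceT cf).
by exists c => // x Ax; apply: cmin; exact: mem_set.
Qed.

Lemma closed_sublevel (T : topologicalType) (R : realType) (f : T -> R) s :
  continuous f -> closed [set x | f x <= s].
Proof.
by move=> /continuous_closedP /(_ [set y | y <= s]); apply; exact: closed_le.
Qed.

Section MeasurableSelection.
Context {d : measure_display} {Omega : measurableType d} {R : realType}.

Lemma measurable_forall_rat (F : rat -> set Omega) :
  (forall s, measurable (F s)) -> measurable (\bigcap_s F s).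
Proof.
move=> mF; rewrite -[X in measurable X]setCK setC_bigcap.
apply: measurableC; apply: bigcupT_measurable_rat => s.
exact: measurableC.
Qed.

(* A random compact set, in Effros' sense of measurability. *)
Definition random_compact (V : topologicalType) (A : Omega -> set V) :=
  [/\ forall w, A w !=set0, forall w, compact (A w)
    & forall C, closed C -> measurable [set w | (A w `&` C) !=set0]].

Definition argmins (V : topologicalType) (f : Omega -> V -> R)
    (A : Omega -> set V) (w : Omega) : set V :=
  [set x | A w x /\ forall y, A w y -> f w x <= f w y].

(** The minima over [A w] and over its part in [C] coincide unless a rational separates them, so
    countably many sublevel events decide whether [C] meets the argmin. *)
Lemma random_compact_argmins (V : topologicalType) (f : Omega -> V -> R)
    (A : Omega -> set V) :
  (forall w, A w !=set0) -> (forall w, compact (A w)) ->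
  (forall w, continuous (f w)) ->
  (forall C s, closed C ->
     measurable [set w | exists x, [/\ A w x, C x & f w x <= s]]) ->
  random_compact (argmins f A).
Proof.
move=> A0 cA cf mA; split.
- by move=> w; have [c Ac cmin] := compact_argmin (A0 w) (cA w) (cf w); exists c.
- move=> w; have [c Ac cmin] := compact_argmin (A0 w) (cA w) (cf w).
  rewrite (_ : argmins f A w = A w `&` [set x | f w x <= f w c]).
    exact: compact_closedI (cA w) (closed_sublevel (cf w)).
  apply/seteqP; split => x /= [Ax xmin]; first by split => //; exact: xmin.
  by split => // y Ay; apply: le_trans xmin _; exact: cmin.
- move=> C cC.
  pose E (D : set V) (s : R) :=
    [set w | exists x, [/\ A w x, D x & f w x <= s]].
  (* C meets the argmin iff each sublevel set met by A is met by A `&` C *)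
  rewrite (_ : [set w | _] =
      \bigcap_(s : rat) (~` E setT (ratr s) `|` E C (ratr s))).
    apply: measurable_forall_rat => s; apply: measurableU.
      by apply: measurableC; apply: mA; exact: closedT.
    exact: mA.
  apply/seteqP; split => w /=.
    move=> [x [[Ax xmin] Cx]] s _; have [fxs|sfx] := leP (f w x) (ratr s).
      by right; exists x.
    left => -[y [Ay _ fys]]; move: sfx; rewrite ltNge => /negP; apply.
    exact: le_trans (xmin _ Ay) fys.
  move=> H; have [c Ac cmin] := compact_argmin (A0 w) (cA w) (cf w).
  (* A rational level above the minimum yields a point of [A w] in [C], so a minimizer [c'] over the
     intersection exists. *)
  have [s0] : exists s : rat, f w c <= ratr s.
    have /rat_in_itvoo[s] : f w c < f w c + 1 by rewrite ltrDl.
    by rewrite in_itv /= => /andP[/ltW cs _]; exists s.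
  move=> cs0; have /= [[]|[x0 [Ax0 Cx0 _]]] := H s0 Logic.I; first by exists c.
  have [||c' [Ac' Cc'] c'min] := @compact_argmin _ _ (f w) (A w `&` C) _ _ (cf w).
  - by exists x0.
  - exact: compact_closedI.
  exists c'; split => //; split => // y Ay.
  apply: le_trans (cmin _ Ay); rewrite leNgt; apply/negP.
  move=> /rat_in_itvoo[s]; rewrite in_itv /= => /andP[cs sc'].
  have [[]|[x [Ax Cx fxs]]] := H s Logic.I; first by exists c; split => //; exact: ltW.
  have := c'min _ (conj Ax Cx); rewrite leNgt => /negP; apply.
  exact: le_lt_trans fxs sc'.
Qed.

(** By compactness the minimum over [D] is attained, so it is at most [s] iff for every [k] some
    point of a countable dense subset of [D] has value below [s + k.+1%:R^-1]. *)
Lemma measurable_compact_sublevel p (f : Omega -> 'cV[R]_p -> R)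
    (D : set 'cV[R]_p) (s : R) :
  compact D -> (forall w, continuous (f w)) ->
  (forall x, measurable_fun [set: Omega] (f^~ x)) ->
  measurable [set w | exists2 x, D x & f w x <= s].
Proof.
move=> cD cf mf.
have [D0|/set0P[x0 Dx0]] := eqVneq D set0.
  rewrite (_ : [set w | _] = set0) //; apply/seteqP; split => // w [x].
  by rewrite D0.
(* the points pt c k, one in each rational cube that meets D, are dense in D *)
pose near_q (c : 'cV[rat]_p) (k : nat) : set 'cV[R]_p :=
  [set x | D x /\ forall i, `|x i 0 - ratr (c i 0)| < k.+1%:R^-1].
(* When the cube misses [D] the default is [x0], so every [pt ck] lies in [D]. *)
have /choice[pt ptP] : forall ck : 'cV[rat]_p * nat,
    exists x, D x /\ (near_q ck.1 ck.2 !=set0 -> near_q ck.1 ck.2 x).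
  move=> ck; have [[x qx]|nq] := pselect (near_q ck.1 ck.2 !=set0).
    by exists x; split => //; case: qx.
  by exists x0; split.
rewrite (_ : [set w | _] = \bigcap_(k : nat) \bigcup_(ck : 'cV[rat]_p * nat)
    [set w | f w (pt ck) < s + k.+1%:R^-1]).
  apply: bigcap_measurableType => k _.
  apply: countable_bigcupT_measurable => [|ck]; first exact: countableP.
  rewrite -[X in measurable X]setTI.
  rewrite (_ : [set w | _] = (f^~ (pt ck)) @^-1` `]-oo, (s + k.+1%:R^-1)[).
    exact: mf.
  by apply/seteqP; split => w /=; rewrite in_itv.
apply/seteqP; split => w /=.
  move=> [x Dx fxs] k _.
  have k0 : 0 < (k.+1%:R^-1 : R) by rewrite invr_gt0.
  have : nbhs x [set y | f w y < s + k.+1%:R^-1].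
    have := cf w x; move/cvgr_lt => /(_ (s + k.+1%:R^-1)); apply.
    by apply: le_lt_trans fxs _; rewrite ltrDl.
  move=> /nbhs_ballP[e /= e0 xe].
  (* Half the radius: [x] and the chosen point are each within [j.+1%:R^-1] of the rational
     centre. *)
  have [j je] : exists j : nat, j.+1%:R^-1 < e / 2.
    have e2 : 0 < e / 2 by rewrite divr_gt0.
    have [j _ /(_ j (leqnn j))] := near_infty_natSinv_lt (PosNum e2).
    by exists j.
  have /choice[c cP] : forall i : 'I_p, exists q : rat,
      `|x i 0 - ratr q| < j.+1%:R^-1.
    move=> i; have j0 : 0 < (j.+1%:R^-1 : R) by rewrite invr_gt0.
    have /rat_in_itvoo[q] : x i 0 < x i 0 + j.+1%:R^-1 by rewrite ltrDl.
    rewrite in_itv /= => /andP[q1 q2]; exists q.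
    by rewrite ltr0_norm ?subr_lt0 // opprB ltrBlDl.
  exists (\col_i c i, j) => //=; apply: xe.
  have [_ /=] := ptP (\col_i c i, j).
  have ex : near_q (\col_i c i) j !=set0.
    by exists x; split => // i; rewrite mxE.
  move=> /(_ ex)[_ ptq]; split => // i k'.
  rewrite (ord1 k') -ball_normE /=.
  have := ptq i; rewrite mxE => h1; have h2 := cP i.
  rewrite (_ : x i 0 - _ = (x i 0 - ratr (c i)) - (pt (\col_i0 c i0, j) i 0 - ratr (c i)));
    last by ring.
  apply: le_lt_trans (ler_normB _ _) _.
  by apply: lt_le_trans (ltrD h2 h1) _; rewrite [leRHS]splitr lerD // ltW.
move=> H; have [c Dc cmin] : exists2 c, D c & forall x, D x -> f w c <= f w x.
  by apply: compact_argmin => //; exists x0.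
exists c => //; rewrite leNgt; apply/negP => sfc.
have e0 : 0 < f w c - s by rewrite subr_gt0.
have [j _ /(_ j (leqnn j)) /= je] := near_infty_natSinv_lt (PosNum e0).
have [ck _ /=] := H j Logic.I; rewrite ltNge => /negP; apply.
apply: le_trans (cmin _ (ptP ck).1).
by rewrite -lerBrDl; exact: ltW je.
Qed.

Lemma random_compact_selection p (A : Omega -> set 'cV[R]_p) :
  random_compact A ->
  exists h : Omega -> 'cV[R]_p, (forall w, A w (h w)) /\ random_mx h.
Proof.
move=> rA.
(* lexicographic minimisation of the coordinates singles out one point *)
have [A' [rA' sA' uA']] : exists A' : Omega -> set 'cV[R]_p,
    [/\ random_compact A', forall w, A' w `<=` A w
      & forall w (i : 'I_p) x y, A' w x -> A' w y -> x i 0 = y i 0].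
  suff [A' [rA' sA' uA']] : exists A' : Omega -> set 'cV[R]_p,
      [/\ random_compact A', forall w, A' w `<=` A w
      & forall w i, i \in enum 'I_p ->
          forall x y, A' w x -> A' w y -> x i 0 = y i 0].
    by exists A'; split => // w i; apply: uA'; rewrite mem_enum.
  (* Coordinates already minimized are constant on [B w], hence also on the argmin taken inside
     it. *)
  elim: (enum 'I_p) => [|i s [B [rB sB uB]]]; first by exists A; split => [|w|].
  have [B0 cB mB] := rB.
  have ci : continuous (fun x : 'cV[R]_p => x i 0) by exact: coord_continuous.
  exists (argmins (fun _ (x : 'cV[R]_p) => x i 0) B); split.
  - apply: random_compact_argmins => // C t cC.
    rewrite (_ : [set w | _] =
      [set w | B w `&` (C `&` [set x : 'cV[R]_p | x i 0 <= t]) !=set0]).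
      by apply: mB; apply: closedI => //; exact: closed_sublevel.
    apply/seteqP; split => w /= [x].
      by move=> [? ? ?]; exists x.
    by move=> [? [? ?]]; exists x.
  - by move=> w x [Bx _]; exact: sB.
  - move=> w j; rewrite inE => /orP[/eqP ->|js] x y [Bx xm] [By ym].
      by apply/eqP; rewrite eq_le xm //= ym.
    exact: uB js _ _ Bx By.
have [A0 _ mA] := rA'.
have [h hP] := choice A0.
exists h; split=> [w|i j]; first exact: sA'.
(* The rays [[t, +oo[] generate the Borel sets. All points of [A' w] share their coordinates, so the
   event that coordinate [i] of [h] is at least [t] is the event that [A' w] meets a closed
   half-space. *)
rewrite (ord1 j) => mT; apply: (measurability _ (RGenCInfty.measurableE R)) => //.
move=> /= _ [_ [t ->] <-]; rewrite setTI.
have cC : closed [set x : 'cV[R]_p | t <= x i 0].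
  have : closed [set x : 'cV[R]_p | - x i 0 <= - t].
    apply: closed_sublevel => x; apply: continuousN; exact: coord_continuous.
  by congr closed; apply/seteqP; split => x /=; rewrite lerN2.
rewrite (_ : _ @^-1` _ = [set w | A' w `&` [set x | t <= x i 0] !=set0]).
  exact: mA.
apply/seteqP; split => w /=; rewrite in_itv /= andbT.
  by move=> th; exists (h w).
by move=> [x [A'x /= tx]]; rewrite (uA' w i _ x).
Qed.

Lemma measurable_minimizer p (f : Omega -> 'cV[R]_p -> R)
    (D : set 'cV[R]_p) :
  D !=set0 -> compact D -> (forall w, continuous (f w)) ->
  (forall x, measurable_fun [set: Omega] (f^~ x)) ->
  exists h : Omega -> 'cV[R]_p, random_mx h /\
    forall w, D (h w) /\ forall x, D x -> f w (h w) <= f w x.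
Proof.
move=> D0 cD cf mf.
have : random_compact (argmins f (fun=> D)).
  apply: random_compact_argmins => // C s cC.
  have := measurable_compact_sublevel s (compact_closedI cD cC) cf mf.
  congr measurable; apply/seteqP; split => w [x].
    by move=> [? ?] ?; exists x.
  by move=> [? ? ?]; exists x.
by move=> /random_compact_selection[h [hP mh]]; exists h.
Qed.

End MeasurableSelection.

(** * Expectation and independence *)

Section ExpectedValue.
Context {d : measure_display} {Omega : measurableType d} {R : realType}.
Variable P : probability Omega R.
Implicit Types f g : Omega -> R.

(** A real-valued expectation. Since [fine] returns 0 on infinite values, the rules that split or
    scale it assume integrability. *)
Definition Ex f : R := fine 'E_P[f].

Definition intg f : Prop := f \in Lfun P 1.

Definition sqintg f : Prop :=
  measurable_fun [set: Omega] f /\ intg (fun w => f w ^+ 2).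

Lemma intgP f : intg f <-> P.-integrable [set: Omega] (EFin \o f).
Proof. exact: Lfun1_integrable. Qed.

Lemma measurable_intg f : intg f -> measurable_fun [set: Omega] f.
Proof. by move/intgP/measurable_int/measurable_EFinP. Qed.

Lemma le_intg f g : measurable_fun [set: Omega] f ->
  (forall w, `|f w| <= g w) -> intg g -> intg f.
Proof.
move=> mf fg /intgP ig; apply/intgP; apply: le_integrable ig => //.
  exact/measurable_EFinP.
by move=> w _ /=; rewrite lee_fin (le_trans (fg w)) // ler_norm.
Qed.

Lemma intgD f g : intg f -> intg g -> intg (fun w => f w + g w).
Proof. by move=> /intgP If /intgP Ig; apply/intgP; exact: (integrableD measurableT If Ig). Qed.

Lemma intgZ c f : intg f -> intg (fun w => c * f w).
Proof. by move=> /intgP If; apply/intgP; exact: (integrableZl measurableT c If). Qed.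

Lemma intg_cst c : intg (fun=> c).
Proof. exact: Lfun_cst. Qed.

Lemma intg_sum (I : Type) (s : seq I) (F : I -> Omega -> R) :
  (forall i, intg (F i)) -> intg (fun w => \sum_(i <- s) F i w).
Proof.
move=> iF; elim: s => [|i s IHs].
  by under eq_fun do rewrite big_nil; exact: intg_cst.
by under eq_fun do rewrite big_cons; exact: intgD.
Qed.

Lemma intg_abs f : intg f -> intg (fun w => `|f w|).
Proof. by move=> If; exact: Lfun_norm. Qed.

Lemma ExE f : intg f -> ('E_P[f] = (Ex f)%:E)%E.
Proof. by move=> If; rewrite fineK //; exact: expectation_fin_num. Qed.

Lemma Ex_integral f : Ex f = fine (\int[P]_w (f w)%:E)%E.
Proof. by rewrite /Ex unlock. Qed.

Lemma ExD f g : intg f -> intg g -> Ex (fun w => f w + g w) = Ex f + Ex g.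
Proof.
by move=> If Ig; rewrite /Ex expectationD // fineD // expectation_fin_num.
Qed.

Lemma Ex_cst c : Ex (fun=> c) = c.
Proof. by rewrite /Ex expectation_cst. Qed.

Lemma ExZ c f : intg f -> Ex (fun w => c * f w) = c * Ex f.
Proof.
move=> If; rewrite /Ex (_ : (fun w => _) = c \o* f); last first.
  by apply/funext => w /=; rewrite mulrC.
by rewrite expectationZl // fineM // expectation_fin_num.
Qed.

Lemma Ex_sum (I : Type) (s : seq I) (F : I -> Omega -> R) :
  (forall i, intg (F i)) ->
  Ex (fun w => \sum_(i <- s) F i w) = \sum_(i <- s) Ex (F i).
Proof.
move=> iF; elim: s => [|i s IHs].
  by under eq_fun do rewrite big_nil; rewrite big_nil Ex_cst.
under eq_fun do rewrite big_cons.
by rewrite big_cons ExD ?IHs //; exact: intg_sum.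
Qed.

Lemma Ex_ge0 f : (forall w, 0 <= f w) -> 0 <= Ex f.
Proof. by move=> f0; rewrite fine_ge0 // expectation_ge0. Qed.

Lemma le_Ex f g : intg f -> intg g -> (forall w, f w <= g w) -> Ex f <= Ex g.
Proof.
move=> If Ig fg; rewrite -subr_ge0 -[- Ex f]mulN1r -ExZ // -ExD //.
  by apply: Ex_ge0 => w; rewrite mulN1r subr_ge0.
exact: intgZ.
Qed.

Lemma markov_Ex f e : intg f -> (forall w, 0 <= f w) -> 0 < e ->
  (P [set w | (e <= f w)%R] <= (Ex f / e)%:E)%E.
Proof.
move=> If f0 e0; have mf := measurable_intg If.
have : (e%:E * P [set w | (e <= f w)%R] <= 'E_P[f])%E.
  have -> : [set w | (e <= f w)%R] = [set w | (e%:E <= `|(f w)%:E|)%E].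
    by apply/seteqP; split => w /=; rewrite lee_fin ger0_norm.
  pose X : {mfun Omega >-> R} := HB.pack f (isMeasurableFun.Build _ _ _ _ f mf).
  have := @markov _ _ _ P X id e e0 (@measurable_id _ _ _).
  move=> /(_ (fun r r0 => r0) (fun x y _ _ xy => xy)) /=.
  congr (_ <= 'E_P[_])%E; apply/funext => w /=; exact: ger0_norm.
rewrite ExE // -lee_pdivlMl // => /le_trans; apply.
by rewrite -EFinM mulrC.
Qed.

(** The product is dominated by [f w ^+ 2 + g w ^+ 2]. *)
Lemma sqintgM f g : sqintg f -> sqintg g -> intg (fun w => f w * g w).
Proof.
move=> [mf f2] [mg g2].
apply: (@le_intg _ (fun w => f w ^+ 2 + g w ^+ 2)) (intgD f2 g2).
  exact: measurable_funM.
move=> w; rewrite normrM -(real_normK (num_real (f w))).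
rewrite -[g w ^+ 2](real_normK (num_real (g w))); nra.
Qed.

Lemma sqintg_cst c : sqintg (fun=> c).
Proof. by split; [exact: measurable_cst|exact: intg_cst]. Qed.

Lemma sqintg_intg f : sqintg f -> intg f.
Proof.
move=> sf; have := sqintgM sf (sqintg_cst 1).
by under eq_fun do rewrite mulr1.
Qed.

Lemma sqintgD f g : sqintg f -> sqintg g -> sqintg (fun w => f w + g w).
Proof.
move=> sf sg; split; first by apply: measurable_funD; [case: sf|case: sg].
have := intgD (intgD sf.2 sg.2) (intgZ 2 (sqintgM sf sg)).
congr intg; apply/funext => w; ring.
Qed.

Lemma sqintgZ c f : sqintg f -> sqintg (fun w => c * f w).
Proof.
move=> [mf f2]; split; first by apply: measurable_funM.
have := intgZ (c ^+ 2) f2.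
congr intg; apply/funext => w; ring.
Qed.

Lemma sqintg_sum (I : Type) (s : seq I) (F : I -> Omega -> R) :
  (forall i, sqintg (F i)) -> sqintg (fun w => \sum_(i <- s) F i w).
Proof.
move=> iF; elim: s => [|i s IHs].
  by under eq_fun do rewrite big_nil; exact: sqintg_cst.
by under eq_fun do rewrite big_cons; exact: sqintgD.
Qed.

Lemma Lfun2_sqintg f : f \in Lfun P 2%:E -> sqintg f.
Proof.
move=> f2; split; last by apply/intgP; exact: Lfun2_integrable_sqr.
by move: f2; rewrite inE => /andP[/[!inE]].
Qed.

Lemma bounded_sqintg f M : measurable_fun [set: Omega] f ->
  (forall w, `|f w| <= M) -> sqintg f.
Proof.
move=> mf fM; split => //.
apply: (@le_intg _ (fun=> M ^+ 2)) (intg_cst _).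
  exact: measurable_funX.
by move=> w; rewrite normrX lerXn2r // nnegrE // (le_trans _ (fM w)).
Qed.

End ExpectedValue.

Section Independence.
Context {d : measure_display} {Omega : measurableType d} {R : realType}.
Variable P : probability Omega R.

(** The law of the pair agrees with the product of the marginal laws on rectangles, hence
    everywhere, and Fubini's theorem splits the integral of the product. *)
Lemma Ex_indep (X Y : Omega -> R) : sqintg P X -> sqintg P Y ->
  (forall A B, measurable A -> measurable B ->
     P (X @^-1` A `&` Y @^-1` B) = (P (X @^-1` A) * P (Y @^-1` B))%E) ->
  Ex P (fun w => X w * Y w) = Ex P X * Ex P Y.
Proof.
move=> sX sY ind; have iX := sqintg_intg sX; have iY := sqintg_intg sY.
have [[mX _] [mY _]] := (sX, sY).
pose X' : {mfun Omega >-> R} := HB.pack X (isMeasurableFun.Build _ _ _ _ X mX).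
pose Y' : {mfun Omega >-> R} := HB.pack Y (isMeasurableFun.Build _ _ _ _ Y mY).
pose XY w := (X w, Y w).
have mXY : measurable_fun [set: Omega] XY by exact: measurable_fun_pair.
pose XY' : {mfun Omega >-> (R * R)%type} :=
  HB.pack XY (isMeasurableFun.Build _ _ _ _ XY mXY).
pose m1 : probability R R := distribution P X'.
pose m2 : probability R R := distribution P Y'.
pose m12 : probability _ R := distribution P XY'.
have m12E A : measurable A -> (m1 \x m2)%E A = m12 A.
  apply: product_measure_unique => B C mB mC.
  by rewrite /m12 /m1 /m2 /= /distribution /pushforward -ind.
pose h (p : R * R) := (p.1 * p.2)%:E.
have mh : measurable_fun [set: (R * R)%type] h.
  by apply/measurable_EFinP; apply: measurable_funM.
have ih : P.-integrable [set: Omega] (h \o XY').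
  by apply/intgP; exact: sqintgM.
have ih12 : m12.-integrable [set: (R * R)%type] h.
  exact: integrable_pushforward.
have ihp : (m1 \x m2)%E.-integrable [set: (R * R)%type] h.
  apply/integrableP; split => //.
  rewrite (@eq_measure_integral _ _ _ _ m12) //; first by case/integrableP : ih12.
  by move=> A mA _; exact: m12E.
have iid1 : P.-integrable [set: Omega] (EFin \o X') by exact/intgP.
have iid2 : P.-integrable [set: Omega] (EFin \o Y') by exact/intgP.
have mid : measurable_fun [set: R] (@EFin R) by exact/measurable_EFinP.
have E1 : (\int[m1]_x x%:E = (Ex P X)%:E)%E.
  by rewrite integral_distribution // -ExE // unlock.
have E2 : (\int[m2]_x x%:E = (Ex P Y)%:E)%E.
  by rewrite integral_distribution // -ExE // unlock.
rewrite Ex_integral.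
transitivity (fine (\int[m12]_p h p)%E).
  by rewrite integral_distribution.
rewrite (@eq_measure_integral _ _ _ _ (m1 \x m2)%E); last first.
  by move=> A mA _; rewrite /= -m12E.
rewrite -integral12_prod_meas1 // /fubini_F /h /=.
have -> : (fun x => \int[m2]_y (x * y)%:E)%E = (fun x => x%:E * (Ex P Y)%:E)%E.
  apply/funext => x; under eq_integral do rewrite EFinM.
  rewrite integralZl //= ?E2 //.
  exact: (@integrable_pushforward _ _ _ _ _ Y' _ P setT).
rewrite integralZr //= ?E1 //.
exact: (@integrable_pushforward _ _ _ _ _ X' _ P setT).
Qed.

End Independence.

(** * Weak law of large numbers *)

Section WeakLaw.
Context {d : measure_display} {Omega : measurableType d} {R : realType}.
Variable P : probability Omega R.
Implicit Types (Y Z : nat -> Omega -> R).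

(* Convergence to 0 in probability, in a form that does not require Z n to be
   measurable. *)
Definition smallp Z : Prop :=
  forall e delta : R, 0 < e -> 0 < delta ->
  exists N, forall n, (N <= n)%N ->
  exists A, [/\ measurable A, (P A <= delta%:E)%E
              & forall w, ~ A w -> `|Z n w| <= e].

Lemma smallp_le Z Z' : smallp Z ->
  (forall n w, (0 < n)%N -> `|Z' n w| <= `|Z n w|) -> smallp Z'.
Proof.
move=> sZ ZZ e delta e0 d0; have [N NP] := sZ _ _ e0 d0.
exists (maxn N 1) => n; rewrite geq_max => /andP[Nn n0].
have [A [mA PA Ae]] := NP n Nn; exists A; split => // w Aw.
exact: le_trans (ZZ _ _ n0) (Ae _ Aw).
Qed.

Lemma smallpD Z Z' : smallp Z -> smallp Z' ->
  smallp (fun n w => Z n w + Z' n w).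
Proof.
move=> sZ sZ' e delta e0 d0.
have e2 : 0 < e / 2 by rewrite divr_gt0.
have d2 : 0 < delta / 2 by rewrite divr_gt0.
have [N NP] := sZ _ _ e2 d2; have [N' NP'] := sZ' _ _ e2 d2.
exists (maxn N N') => n; rewrite geq_max => /andP[Nn N'n].
have [A [mA PA Ae]] := NP n Nn; have [B [mB PB Be]] := NP' n N'n.
exists (A `|` B); split; first exact: measurableU.
  rewrite (splitr delta) EFinD; apply: le_trans (leeD PA PB).
  exact: measureU2.
move=> w /not_orP[/Ae Aw /Be Bw]; rewrite (splitr e).
by apply: le_trans (ler_normD _ _) _; exact: lerD.
Qed.

Lemma smallp0 : smallp (fun _ _ => 0).
Proof.
move=> e delta e0 d0; exists 0%N => n _; exists set0; split => //.
  by rewrite measure0 lee_fin ltW.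
by move=> w _; rewrite normr0 ltW.
Qed.

Lemma smallpM Z Z' : smallp Z -> smallp Z' ->
  smallp (fun n w => Z n w * Z' n w).
Proof.
move=> sZ sZ' e delta e0 d0.
(* Off the exceptional sets one factor is at most 1 and the other at most [e]. *)
have e1 : 0 < Num.min 1 e by rewrite lt_min ltr01.
have d2 : 0 < delta / 2 by rewrite divr_gt0.
have [N NP] := sZ _ _ e1 d2; have [N' NP'] := sZ' _ _ e1 d2.
exists (maxn N N') => n; rewrite geq_max => /andP[Nn N'n].
have [A [mA PA Ae]] := NP n Nn; have [B [mB PB Be]] := NP' n N'n.
exists (A `|` B); split; first exact: measurableU.
  rewrite (splitr delta) EFinD; apply: le_trans (leeD PA PB).
  exact: measureU2.
move=> w /not_orP[/Ae + /Be]; rewrite !le_min => /andP[A1 _] /andP[_ Be'].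
by rewrite normrM -[e]mul1r ler_pM.
Qed.

Lemma smallp_sum_norm (I : finType) (F : I -> nat -> Omega -> R) :
  (forall i, smallp (F i)) -> smallp (fun n w => \sum_i `|F i n w|).
Proof.
move=> sF; elim: (index_enum I) => [|i s IHs].
  by apply: smallp_le smallp0 _ => n w _; rewrite big_nil.
have sFi : smallp (fun n w => `|F i n w|).
  by apply: smallp_le (sF i) _ => n w _; rewrite normr_id.
by apply: smallp_le (smallpD sFi IHs) _ => n w _; rewrite big_cons.
Qed.

Lemma smallp_sqr Z : smallp (fun n w => Z n w ^+ 2) -> smallp Z.
Proof.
move=> sZ e delta e0 d0; have [|N NP] := sZ (e ^+ 2) delta _ d0.
  by rewrite exprn_gt0.
exists N => n /NP[A [mA PA Ae]]; exists A; split => // w /Ae.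
by rewrite normrX ler_sqr // nnegrE ltW.
Qed.

(** Markov's inequality at level [e]; [n] is taken so large that [|c| / n] is at most
    [e * delta]. *)
Lemma smallp_Ex (Z : nat -> Omega -> R) (c : R) :
  (forall n w, 0 <= Z n w) -> (forall n, intg P (Z n)) ->
  (forall n, (0 < n)%N -> Ex P (Z n) <= c / n%:R) -> smallp Z.
Proof.
move=> Z0 iZ ZE e delta e0 d0.
have ed0 : 0 < e * delta by rewrite mulr_gt0.
have x0 : 0 <= `|c| / (e * delta) by rewrite divr_ge0 // ltW.
exists (Num.bound (`|c| / (e * delta))).+1 => n bn.
exists [set w | e <= Z n w]; split.
- rewrite -[X in measurable X]setTI.
  rewrite (_ : [set w | _] = Z n @^-1` `[e, +oo[).
    exact: (measurable_intg (iZ n)).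
  by apply/seteqP; split => w /=; rewrite in_itv /= andbT.
- apply: le_trans (markov_Ex (iZ n) (Z0 n) e0) _; rewrite lee_fin.
  have n0 : (0 < n)%N by exact: leq_trans bn.
  rewrite ler_pdivrMr // (le_trans (ZE _ n0)) // ler_pdivrMr ?ltr0n //.
  have : `|c| / (e * delta) <= n%:R.
    by apply: ltW (lt_le_trans (archi_boundP x0) _); rewrite ler_nat ltnW.
  rewrite ler_pdivrMr // => h; rewrite (le_trans (ler_norm _)) // (le_trans h) //.
  by rewrite mulrC (mulrC e).
- by move=> w /negP; rewrite -ltNge => /ltW; rewrite ger0_norm.
Qed.

(** Independence of pairs is what removes the cross terms from the variance of a sum. *)
Definition pairwise_iid Y : Prop :=
  [/\ forall i, measurable_fun [set: Omega] (Y i),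
      forall i j A B, i != j -> measurable A -> measurable B ->
        P (Y i @^-1` A `&` Y j @^-1` B) =
        (P (Y i @^-1` A) * P (Y j @^-1` B))%E
    & forall i A, measurable A -> P (Y i @^-1` A) = P (Y 0%N @^-1` A)].

Lemma pairwise_iid_comp Y (g : R -> R) : measurable_fun [set: R] g ->
  pairwise_iid Y -> pairwise_iid (fun i w => g (Y i w)).
Proof.
move=> mg [mY indY idY].
have mgA A : measurable A -> measurable (g @^-1` A).
  by move=> mA; rewrite -[X in measurable X]setTI; exact: mg.
split=> [i|i j A B ij mA mB|i A mA].
- exact: (measurableT_comp mg (mY i)).
- exact: (indY i j _ _ ij (mgA _ mA) (mgA _ mB)).
- exact: (idY i _ (mgA _ mA)).
Qed.

Lemma Ex_pairwise_iid Y i : pairwise_iid Y -> (forall i, intg P (Y i)) ->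
  Ex P (Y i) = Ex P (Y 0%N).
Proof.
move=> [mY _ idY] iY.
pose Y' j : {mfun Omega >-> R} :=
  HB.pack (Y j) (isMeasurableFun.Build _ _ _ _ (Y j) (mY j)).
have mid : measurable_fun [set: R] (@EFin R) by exact/measurable_EFinP.
have E j : Ex P (Y j) = fine (\int[distribution P (Y' j)]_x x%:E)%E.
  have iYj : P.-integrable [set: Omega] (EFin \o Y' j) by exact/intgP/iY.
  by rewrite integral_distribution // Ex_integral.
rewrite !E; congr fine; apply: eq_measure_integral => A mA _.
exact: idY.
Qed.

(** Cross terms vanish by independence and centering, and the diagonal terms share the second moment
    of [Y 0]. *)
Lemma Ex_weighted_sum2 Y (c : nat -> R) n :
  pairwise_iid Y -> (forall i, sqintg P (Y i)) -> Ex P (Y 0%N) = 0 ->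
  Ex P (fun w => (\sum_(i < n) c i * Y i w) ^+ 2) =
  Ex P (fun w => Y 0%N w ^+ 2) * \sum_(i < n) c i ^+ 2.
Proof.
move=> pY sY Y0.
have YY i j : Ex P (fun w => Y i w * Y j w) =
    (i == j)%:R * Ex P (fun w => Y 0%N w ^+ 2).
  have [<-|ij] := eqVneq i j.
    rewrite mul1r -(@Ex_pairwise_iid (fun i w => Y i w ^+ 2) i) //.
      by apply: (@pairwise_iid_comp Y (fun x => x ^+ 2)) => //; exact: measurable_funX.
    by move=> k; case: (sY k).
  have [_ ind _] := pY.
  rewrite mul0r Ex_indep //; last by move=> A B; exact: ind.
  by rewrite (Ex_pairwise_iid i pY) ?Y0 ?mul0r // => k; exact: sqintg_intg.
have iYY i j : intg P (fun w => Y i w * Y j w) by exact: sqintgM.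
under eq_fun => w.
  rewrite expr2 mulr_suml.
  under eq_bigr => i _.
    rewrite mulr_sumr.
    under eq_bigr => j _.
      rewrite (_ : _ * _ = (c i * c j) * (Y i w * Y j w)); last by ring.
      over.
    over.
  over.
rewrite Ex_sum; last by move=> i; apply: intg_sum => j; exact: intgZ.
rewrite mulr_sumr; apply: eq_bigr => i _.
rewrite Ex_sum; last by move=> j; exact: intgZ.
rewrite (bigD1 i) //= big1 ?addr0 => [|j ji].
  by rewrite ExZ // YY eqxx mul1r -expr2 mulrC.
rewrite ExZ // YY (_ : (_ == _) = false) ?mul0r ?mulr0 //.
by apply/negbTE; move: ji; rewrite eq_sym.
Qed.

(** The expectation is at most the second moment of [Y 0] divided by [n], for any weights of norm at
    most 1, even weights that change with [n]. It serves for inner products with the frame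
    vectors. *)
Lemma smallp_weighted_sum2 Y (c : nat -> nat -> R) :
  pairwise_iid Y -> (forall i, sqintg P (Y i)) -> Ex P (Y 0%N) = 0 ->
  (forall n, \sum_(i < n) c n i ^+ 2 <= 1) ->
  smallp (fun n w => n%:R^-1 * (\sum_(i < n) c n i * Y i w) ^+ 2).
Proof.
move=> pY sY Y0 c1; have sS n : sqintg P (fun w => \sum_(i < n) c n i * Y i w).
  by apply: sqintg_sum => i; exact: sqintgZ.
apply: (@smallp_Ex _ (Ex P (fun w => Y 0%N w ^+ 2))).
- by move=> n w; rewrite mulr_ge0 ?invr_ge0 ?sqr_ge0.
- by move=> n; apply: intgZ; case: (sS n).
- move=> n n0; rewrite ExZ; last by case: (sS n).
  rewrite (Ex_weighted_sum2 (c n)) // mulrC ler_wpM2r ?invr_ge0 //.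
  by rewrite ler_piMr // Ex_ge0 // => w; exact: sqr_ge0.
Qed.

Let clip (M y : R) : R := Num.max (- M) (Num.min y M).

Let measurable_clip M : measurable_fun [set: R] (clip M).
Proof.
apply: measurable_maxr; first exact: measurable_cst.
by apply: measurable_minr; [exact: measurable_id|exact: measurable_cst].
Qed.

Let clip_bounded M y : 0 <= M -> `|clip M y| <= M.
Proof.
move=> M0; rewrite ler_norml /clip le_max lexx /= ge_max ge_min lexx orbT andbT.
lra.
Qed.

Let clip_dist M y : 0 <= M -> `|y - clip M y| <= `|y|.
Proof.
move=> M0; rewrite /clip; have [yM|yM] := leP y M.
  have [My|My] := leP (- M) y; first by rewrite subrr normr0.
  by rewrite !ler0_norm; lra.
by rewrite max_r ?ger0_norm; lra.
Qed.

Let clip_id M y : `|y| <= M -> clip M y = y.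
Proof.
by rewrite ler_norml => /andP[y1 y2]; rewrite /clip min_l // max_r.
Qed.

(** Dominated convergence as the level grows: the error is bounded by [|X w|] and is 0 once the
    level exceeds [|X w|]. *)
Lemma truncation_error (X : Omega -> R) (e : R) : intg P X -> 0 < e ->
  exists2 M, 0 <= M & Ex P (fun w => `|X w - clip M (X w)|) <= e.
Proof.
move=> iX e0; have mX := measurable_intg iX.
have mD (M : nat) : measurable_fun [set: Omega] (fun w => `|X w - clip M%:R (X w)|).
  apply: measurableT_comp => //; apply: measurable_funB => //.
  exact: (measurableT_comp (measurable_clip _)).
have [|||||_ _ H] := @dominated_convergence _ _ _ P setT measurableT
   (fun (M : nat) w => (`|X w - clip M%:R (X w)|)%:E) (cst 0%E)
   (fun w => (`|X w|)%:E).
- by move=> M; exact/measurable_EFinP.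
- exact: measurable_cst.
- apply: aeW => w _; apply: cvg_near_cst.
  exists (Num.bound (`|X w|)) => // M /= bM.
  rewrite clip_id ?subrr ?normr0 //.
  by rewrite (le_trans (ltW (archi_boundP _))) ?ler_nat.
- by apply/intgP; exact: intg_abs.
- by apply: aeW => w M _ /=; rewrite lee_fin normr_id clip_dist.
move: H; rewrite integral_cst //= mul0e => /fine_cvg /cvgrPdist_lt /(_ e e0).
move=> [M _ /(_ M (leqnn M))]; rewrite sub0r normrN /= -Ex_integral => Me.
by exists M%:R => //; apply: le_trans (ler_norm _) (ltW Me).
Qed.

(** The deviation splits into three parts of size at most [e / 3]: the centered mean of the clipped
    variables, whose variance is of order [1 / n]; the mean truncation error, controlled by Markov's
    inequality; and the bias of the clipped expectation. *)
Theorem weak_law Y : pairwise_iid Y -> (forall i, intg P (Y i)) ->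
  smallp (fun n w => n%:R^-1 * \sum_(i < n) Y i w - Ex P (Y 0%N)).
Proof.
move=> pY iY e delta e0 d0.
have e3 : 0 < e / 3 by rewrite divr_gt0.
have d2 : 0 < delta / 2 by rewrite divr_gt0.
(* The first bound controls the bias, the second makes the Markov bound for the truncation error at
   most [delta / 2]. *)
have t0 : 0 < Num.min (e / 3) (e / 3 * (delta / 2)).
  by rewrite lt_min e3 mulr_gt0.
have [M M0 EM] := truncation_error (iY 0%N) t0.
have mcl := measurable_clip M.
pose c := Ex P (fun w => clip M (Y 0%N w)).
pose G y := `|y - clip M y|.
have mG : measurable_fun [set: R] G.
  by apply: measurableT_comp => //; apply: measurable_funB.
have [mY _ _] := pY.
have pG : pairwise_iid (fun i w => G (Y i w)) by exact: pairwise_iid_comp.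
have iG i : intg P (fun w => G (Y i w)).
  apply: (@le_intg _ _ _ _ _ (fun w => `|Y i w|)) (intg_abs (iY i)).
    exact: (measurableT_comp mG (mY i)).
  by move=> w; rewrite normr_id clip_dist.
have sclip i : sqintg P (fun w => clip M (Y i w)).
  apply: (@bounded_sqintg _ _ _ _ _ M); first exact: (measurableT_comp mcl (mY i)).
  by move=> w; exact: clip_bounded.
have small_clip : smallp (fun n w =>
    n%:R^-1 * \sum_(i < n) (clip M (Y i w) - c)).
  apply: smallp_sqr.
  pose W i w := clip M (Y i w) - c.
  have pW : pairwise_iid W.
    apply: (@pairwise_iid_comp Y (fun y => clip M y - c)) => //.
    by apply: measurable_funB.
  have sW i : sqintg P (W i) by apply: sqintgD => //; exact: sqintg_cst.
  have W0 : Ex P (W 0%N) = 0.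
    rewrite ExD ?Ex_cst ?subrr //; last exact: intg_cst.
    exact: sqintg_intg.
  (* Unit weights put the sum in the form of [Ex_weighted_sum2]. *)
  have sS n : sqintg P (fun w => \sum_(i < n) 1 * W i w).
    by apply: sqintg_sum => i; exact: sqintgZ.
  have eW n w : (n%:R^-1 * \sum_(i < n) (clip M (Y i w) - c)) ^+ 2 =
      n%:R^-1 ^+ 2 * (\sum_(i < n) 1 * W i w) ^+ 2.
    by rewrite exprMn; congr (_ * _ ^+ 2); apply: eq_bigr => i _; rewrite mul1r.
  apply: (@smallp_Ex _ (Ex P (fun w => W 0%N w ^+ 2))).
  - by move=> n w; exact: sqr_ge0.
  - by move=> n; under eq_fun do rewrite eW; apply: intgZ; case: (sS n).
  - move=> n n0; under eq_fun do rewrite eW.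
    rewrite ExZ; last by case: (sS n).
    rewrite (Ex_weighted_sum2 (fun=> 1)) // sumr_const card_ord expr1n.
    rewrite -mulr_natr mul1r mulrC expr2 !mulrA mulfK ?lexx //.
    by rewrite pnatr_eq0 -lt0n.
have [N NP] := small_clip _ _ e3 d2.
exists (maxn N 1) => n; rewrite geq_max => /andP[Nn n0].
have n0R : n%:R != 0 :> R by rewrite pnatr_eq0 -lt0n.
have [A [mA PA Ae]] := NP n Nn.
pose U w := n%:R^-1 * \sum_(i < n) G (Y i w).
have iU : intg P U by apply: intgZ; exact: intg_sum.
have U0 w : 0 <= U w.
  by rewrite mulr_ge0 ?invr_ge0 // sumr_ge0 // => i _; exact: normr_ge0.
have EU : Ex P U = Ex P (fun w => G (Y 0%N w)).
  rewrite ExZ; last exact: intg_sum.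
  rewrite Ex_sum //.
  under eq_bigr do rewrite (Ex_pairwise_iid _ pG) //.
  by rewrite sumr_const card_ord -[Ex _ _ *+ _]mulr_natl mulKf.
have mB : measurable [set w | e / 3 <= U w].
  rewrite -[X in measurable X]setTI.
  rewrite (_ : [set w | _] = U @^-1` `[e / 3, +oo[).
    exact: (measurable_intg iU).
  by apply/seteqP; split => w /=; rewrite in_itv /= andbT.
exists (A `|` [set w | e / 3 <= U w]); split; first exact: measurableU.
  rewrite (splitr delta) EFinD; apply: le_trans (measureU2 _ mA mB) _.
  apply: leeD => //; apply: le_trans (markov_Ex iU U0 e3) _.
  rewrite lee_fin EU ler_pdivrMr // (le_trans EM) //.
  by rewrite ge_min [_ * (e / 3)]mulrC lexx orbT.
move=> w /not_orP[/Ae Aw /negP]; rewrite -ltNge => Uw.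
have -> : n%:R^-1 * (\sum_(i < n) Y i w) - Ex P (Y 0%N) =
    n%:R^-1 * \sum_(i < n) (clip M (Y i w) - c) +
    n%:R^-1 * \sum_(i < n) (Y i w - clip M (Y i w)) + (c - Ex P (Y 0%N)).
  rewrite -mulrDr -big_split /=.
  rewrite [in RHS](eq_bigr (fun i : 'I_n => Y i w - c)) => [|i _]; last by ring.
  by rewrite sumrB sumr_const card_ord -[c *+ _]mulr_natl mulrBr mulKf // addrA subrK.
have cE : `|c - Ex P (Y 0%N)| <= e / 3.
  have ic : intg P (fun w => clip M (Y 0%N w)) by exact: sqintg_intg.
  rewrite distrC /c -[- Ex _ _]mulN1r -ExZ // -ExD //; last exact: intgZ.
  have iD : intg P (fun w => Y 0%N w + -1 * clip M (Y 0%N w)).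
    by apply: intgD => //; exact: intgZ.
  apply: le_trans (_ : _ <= Ex P (fun w => G (Y 0%N w))) _; last first.
    by rewrite (le_trans EM) // ge_min lexx.
  rewrite ler_norml; apply/andP; split.
    rewrite -[- Ex _ _]mulN1r -ExZ //; apply: le_Ex => //; first exact: intgZ.
    by move=> w'; rewrite !mulN1r; exact: lerNnormlW.
  by apply: le_Ex => // w'; rewrite mulN1r ler_norm.
have Uc : `|n%:R^-1 * \sum_(i < n) (Y i w - clip M (Y i w))| <= e / 3.
  apply: le_trans (ltW Uw); rewrite normrM ger0_norm ?invr_ge0 //.
  by rewrite ler_wpM2l ?invr_ge0 // ler_norm_sum.
apply: le_trans (ler_normD _ _) _; apply: le_trans (lerD (ler_normD _ _) (lexx _)) _.
move: Aw; lra.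
Qed.

End WeakLaw.

(** * Finite-sample bound *)

Section FiniteSampleBound.
Context {R : realType}.
Implicit Types (f g h : nat -> R) (n K : nat).

(** Gram-Schmidt without discarding dependent vectors: a [c K] already in the span contributes a
    zero vector, so there are always [K] frame vectors. Sequences stand for vectors through their
    first [n] values. *)
Lemma gram_schmidt n (c : nat -> nat -> R) K :
  exists o : nat -> nat -> R,
  [/\ forall l l', (l < K)%N -> (l' < K)%N -> l != l' ->
        \sum_(i < n) o l i * o l' i = 0,
      forall l, (l < K)%N -> \sum_(i < n) o l i ^+ 2 = 1 \/
        forall i : 'I_n, o l i = 0
    & forall gamma : nat -> R, exists x : nat -> R, forall i : 'I_n,
        \sum_(j < K) gamma j * c j i = \sum_(l < K) x l * o l i].
Proof.
elim: K => [|K [ o [orth norm1 span]]].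
  by exists (fun _ _ => 0); split=> // gamma; exists gamma => i; rewrite !big_ord0.
pose p l := \sum_(i < n) c K i * o l i.
(* [r] is the part of [c K] orthogonal to the earlier frame vectors and [N] its squared norm; the
   new vector is 0 or [r] normalized, according to whether [N] vanishes. *)
pose r i := c K i - \sum_(l < K) p l * o l i.
pose N := \sum_(i < n) r i ^+ 2.
have pP l : (l < K)%N -> \sum_(i < n) r i * o l i = 0.
  move=> lK; under eq_bigr do rewrite mulrBl.
  rewrite sumrB -/(p l); under [X in _ - X]eq_bigr do rewrite mulr_suml.
  rewrite exchange_big /= (bigD1 (Ordinal lK)) //= [X in _ - (_ + X)]big1.
    rewrite addr0; under [X in _ - X]eq_bigr do rewrite -mulrA -expr2.
    rewrite -mulr_sumr; have [->|o0] := norm1 l lK; first by rewrite mulr1 subrr.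
    rewrite /p big1 ?mul0r ?subrr // => i _; by rewrite o0 mulr0.
  move=> l' l'l; under eq_bigr do rewrite -mulrA.
  rewrite -mulr_sumr orth ?mulr0 //.
have N0 : 0 <= N by apply: sumr_ge0 => i _; exact: sqr_ge0.
have [Nz|Npos] := eqVneq N 0.
  have r0 (i : 'I_n) : r i = 0.
    apply/eqP; rewrite -sqrf_eq0; apply/eqP.
    by move: Nz => /psumr_eq0P; apply => // j _; exact: sqr_ge0.
  exists (fun l i => if (l < K)%N then o l i else 0); split.
  - move=> l l' _ _ ll'; case: ltnP => lK; last by rewrite big1 // => i _; rewrite mul0r.
    case: ltnP => l'K; last by rewrite big1 // => i _; rewrite mulr0.
    exact: orth.
  - by move=> l _; case: ltnP => lK; [exact: norm1|right].
  - move=> gamma; have [x xP] := span gamma.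
    exists (fun l => x l + gamma K * p l) => i.
    rewrite !big_ord_recr /= ltnn mulr0 addr0 xP.
    under [in RHS]eq_bigr do rewrite ltn_ord mulrDl -mulrA.
    rewrite big_split /= -mulr_sumr; congr (_ + _ * _).
    by have := r0 i; rewrite /r => /eqP; rewrite subr_eq0 => /eqP.
have sN : Num.sqrt N != 0 by rewrite sqrtr_eq0 -ltNge lt_def Npos.
exists (fun l i => if (l < K)%N then o l i else r i / Num.sqrt N); split.
- move=> l l'; rewrite !ltnS => lK l'K ll'.
  have rK l1 : (l1 < K)%N -> \sum_(i < n) r i / Num.sqrt N * o l1 i = 0.
    move=> l1K; under eq_bigr do rewrite mulrAC.
    by rewrite -mulr_suml pP ?mul0r.
  case: (ltnP l K) => lK1; case: (ltnP l' K) => l'K1.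
  + exact: orth.
  + by under eq_bigr do rewrite mulrC; exact: rK.
  + exact: rK.
  + have lE : l = l' by apply/eqP; rewrite eqn_leq (leq_trans lK) //= (leq_trans l'K).
    by rewrite lE eqxx in ll'.
- move=> l _; case: ltnP => lK; [exact: norm1|left].
  under eq_bigr do rewrite exprMn.
  rewrite -mulr_suml -/N exprVn sqr_sqrtr // divff //.
- move=> gamma; have [x xP] := span gamma.
  exists (fun l => if (l < K)%N then x l + gamma K * p l else gamma K * Num.sqrt N) => i.
  rewrite !big_ord_recr /= ltnn xP.
  under [in RHS]eq_bigr do rewrite ltn_ord mulrDl -mulrA.
  rewrite big_split /= -mulr_sumr -addrA; congr (_ + _).
  rewrite -mulrA [_ * (r i / _)]mulrC divfK // -mulrDr; congr (_ * _).
  by rewrite /r addrC subrK.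
Qed.

(* Satisfied by an orthonormal basis of the span of the c_j padded with zeros. *)
Definition dominating_frame n K (c : 'I_K -> nat -> R) (o : nat -> nat -> R) :
    Prop :=
  (forall l, (l < K)%N -> \sum_(i < n) o l i ^+ 2 <= 1) /\
  forall (gamma : 'I_K -> R) (h e : nat -> R),
    (forall i : 'I_n, h i = \sum_j gamma j * c j i) ->
    - \sum_(l < K) (\sum_(i < n) o l i * e i) ^+ 2 <=
    \sum_(i < n) h i ^+ 2 + 2 * \sum_(i < n) h i * e i.

(** With [h] equal to the sum of [x l * o l] and [s l] the inner product of [o l] with [e], each
    unit vector contributes [x l ^+ 2 + 2 * x l * s l], which is at least [- s l ^+ 2] by completing
    the square; each zero vector contributes 0. *)
Lemma dominating_frame_exists n K (c : 'I_K -> nat -> R) :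
  exists o, dominating_frame n c o.
Proof.
(* [insub] extends the family from ['I_K] to all of [nat] by 0. *)
have [ o [orth norm1 span]] :=
  gram_schmidt n (fun j => oapp c (fun=> 0) (insub j)) K.
exists o; split=> [l lK|gamma h e hE].
  by have [->//|o0] := norm1 l lK; rewrite big1 // => i _; rewrite o0 expr0n.
have [x xP] := span (fun j => oapp gamma 0 (insub j)).
have {}hE (i : 'I_n) : h i = \sum_(l < K) x l * o l i.
  by rewrite hE -xP; apply: eq_bigr => j _; rewrite !valK.
have -> : \sum_(i < n) h i * e i = \sum_(l < K) x l * \sum_(i < n) o l i * e i.
  under eq_bigr do rewrite hE mulr_suml.
  rewrite exchange_big /=; apply: eq_bigr => l _.
  by rewrite mulr_sumr; apply: eq_bigr => i _; rewrite mulrA.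
have -> : \sum_(i < n) h i ^+ 2 = \sum_(l < K) x l ^+ 2 * \sum_(i < n) o l i ^+ 2.
  transitivity (\sum_(i < n) h i * h i); first by under eq_bigr do rewrite expr2.
  under eq_bigr => i _ do rewrite {1}hE mulr_suml.
  rewrite exchange_big /=; apply: eq_bigr => l _.
  transitivity (x l * \sum_(i < n) o l i * h i).
    by rewrite mulr_sumr; apply: eq_bigr => i _; rewrite mulrA.
  rewrite expr2 -mulrA; congr (_ * _).
  under [LHS]eq_bigr => i _ do rewrite hE mulr_sumr.
  rewrite exchange_big /= (bigD1 l) //= [X in _ + X]big1 ?addr0.
    by rewrite mulr_sumr; apply: eq_bigr => i _; rewrite mulrCA -expr2.
  move=> l' l'l; under eq_bigr do rewrite mulrCA.
  by rewrite -mulr_sumr orth ?mulr0 // eq_sym.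
rewrite mulr_sumr -big_split /= -sumrN; apply: ler_sum => l _.
have [->|o0] := norm1 l (ltn_ord l).
  set s := (X in - X ^+ 2); rewrite -[\sum_(i < n) o l i * e i]/s -subr_ge0.
  by rewrite (_ : _ - _ = (x l + s) ^+ 2) ?sqr_ge0 //; ring.
by rewrite !big1 ?expr0n ?mulr0 ?addr0 ?oppr0 // => i _; rewrite o0 ?expr0n ?mul0r.
Qed.

(** Cauchy-Schwarz against the constant vector 1, from [2 * a i * a j <= a i ^+ 2 + a j ^+ 2]. *)
Lemma sqr_sum_le (I : finType) (a : I -> R) :
  (\sum_i a i) ^+ 2 <= #|I|%:R * \sum_i a i ^+ 2.
Proof.
rewrite expr2 mulr_suml.
have -> : #|I|%:R * \sum_i a i ^+ 2 = \sum_i \sum_j (a i ^+ 2 + a j ^+ 2) / 2.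
  have E i : \sum_j (a i ^+ 2 + a j ^+ 2) / 2 =
      (#|I|%:R * a i ^+ 2 + \sum_j a j ^+ 2) / 2.
    by rewrite -mulr_suml big_split /= sumr_const -[_ *+ #|_|]mulr_natl.
  under [RHS]eq_bigr do rewrite E.
  rewrite -mulr_suml big_split /= -mulr_sumr sumr_const -[_ *+ #|_|]mulr_natl.
  lra.
apply: ler_sum => i _; rewrite mulr_sumr; apply: ler_sum => j _.
by have := sqr_ge0 (a i - a j); rewrite sqrrB; lra.
Qed.

(** * Sample means and sample covariances *)

Definition mean n f : R := n%:R^-1 * \sum_(i < n) f i.

Definition scov n f g : R := mean n (fun i => f i * g i) - mean n f * mean n g.

Lemma eq_mean n f g : (forall i, f i = g i) -> mean n f = mean n g.
Proof. by move=> fg; rewrite /mean; under eq_bigr do rewrite fg. Qed.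

Lemma meanD n f g : mean n (fun i => f i + g i) = mean n f + mean n g.
Proof. by rewrite /mean big_split mulrDr. Qed.

Lemma meanZ n a f : mean n (fun i => a * f i) = a * mean n f.
Proof. by rewrite /mean -mulr_sumr mulrCA. Qed.

Lemma mean_sum (I : finType) n (F : I -> nat -> R) :
  mean n (fun i => \sum_k F k i) = \sum_k mean n (F k).
Proof. by rewrite /mean exchange_big mulr_sumr. Qed.

Lemma mean_cst n a : (0 < n)%N -> mean n (fun=> a) = a.
Proof.
move=> n0; rewrite /mean sumr_const card_ord -[a *+ _]mulr_natl mulKf //.
by rewrite pnatr_eq0 -lt0n.
Qed.

Lemma scovC n f g : scov n f g = scov n g f.
Proof.
rewrite /scov [mean n f * _]mulrC; congr (_ - _).
by apply: eq_mean => i; rewrite mulrC.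
Qed.

Lemma scovDl n f g h : scov n (fun i => f i + g i) h = scov n f h + scov n g h.
Proof.
rewrite /scov meanD (eq_mean n (g := fun i => f i * h i + g i * h i)).
  by rewrite meanD; ring.
by move=> i; rewrite mulrDl.
Qed.

Lemma scovZl n a f g : scov n (fun i => a * f i) g = a * scov n f g.
Proof.
rewrite /scov meanZ (eq_mean n (g := fun i => a * (f i * g i))).
  by rewrite meanZ; ring.
by move=> i; rewrite mulrA.
Qed.

Lemma scov_suml (I : finType) n (F : I -> nat -> R) g :
  scov n (fun i => \sum_k F k i) g = \sum_k scov n (F k) g.
Proof.
rewrite /scov mean_sum mulr_suml sumrB; congr (_ - _); rewrite -mean_sum.
by apply: eq_mean => i; rewrite mulr_suml.
Qed.

Lemma scov_cstl n a f : (0 < n)%N -> scov n (fun=> a) f = 0.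
Proof. by move=> n0; rewrite /scov meanZ mean_cst // subrr. Qed.

Lemma eq_scov n f f' g g' : (forall i, f i = f' i) -> (forall i, g i = g' i) ->
  scov n f g = scov n f' g'.
Proof. by move=> /funext -> /funext ->. Qed.

Lemma scov_demeaned n f g : (0 < n)%N ->
  scov n f g = mean n (fun i => (f i - mean n f) * g i).
Proof.
move=> n0; rewrite /scov.
rewrite [RHS](eq_mean n (g := fun i => f i * g i + (- mean n f) * g i)).
  by rewrite meanD meanZ mulNr.
by move=> i; rewrite mulrBl mulNr.
Qed.

Lemma scov_demeaned2 n f : (0 < n)%N ->
  scov n f f = mean n (fun i => (f i - mean n f) ^+ 2).
Proof.
move=> n0; rewrite /scov.
rewrite [RHS](eq_mean n (g := fun i =>
   f i * f i + (- (2 * mean n f)) * f i + mean n f ^+ 2)).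
  by rewrite !meanD meanZ mean_cst //; ring.
by move=> i; ring.
Qed.

(** The deterministic core, for one period. With [h] the part along [c] and [bz] the part along
    [zc], the difference of variances is [scov h h + 2 * scov h (bz + u)], plus [scov bz bz], plus
    [2 * scov bz u]. The frame bounds the first group below whatever the size of [c], the second is
    close to the quadratic form in [V], and the third is small; the three errors add up to the
    stated constant times [rho]. *)
Lemma residual_variance_bound n K m (c : 'I_K -> nat -> R)
    (o : nat -> nat -> R) (V : 'I_m -> 'I_m -> R) (zc : 'I_m -> nat -> R)
    (u : nat -> R) (B rho : R) (gamma : 'I_K -> R) (b : 'I_m -> R) (a : R)
    (r : nat -> R) :
  (0 < n)%N ->
  dominating_frame n (fun j i => c j i - mean n (c j)) o ->
  0 <= B -> 0 <= rho ->
  (forall k l, `|scov n (zc k) (zc l) - V k l| <= rho) ->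
  (forall k, `|scov n (zc k) u| <= rho) ->
  (forall (l : 'I_K) k, n%:R^-1 * (\sum_(i < n) o l i * zc k i) ^+ 2 <= rho) ->
  (forall l : 'I_K, n%:R^-1 * (\sum_(i < n) o l i * u i) ^+ 2 <= rho) ->
  (forall k, `|b k| <= B) ->
  (forall i, r i =
     \sum_j gamma j * c j i + \sum_k b k * zc k i + (a + u i)) ->
  \sum_k \sum_l b k * b l * V k l <=
  scov n r r - scov n u u +
  (m%:R ^+ 2 * B ^+ 2 + 2 * m%:R * B +
   K%:R * (2 * m%:R ^+ 2 * B ^+ 2 + 2)) * rho.
Proof.
move=> n0 [_ oP] B0 rho0 zV zu oz ou bB /funext rE.
pose s i := a + u i.
pose h i := \sum_j gamma j * c j i.
pose bz i := \sum_k b k * zc k i.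
pose e i := bz i + u i.
(* The constant [a] drops out of every covariance. *)
have scov_s f : scov n f s = scov n f u.
  by rewrite scovC scovDl scov_cstl // add0r scovC.
have -> : scov n r r - scov n u u =
    (scov n h h + 2 * scov n h e) + scov n bz bz + 2 * scov n bz u.
  have rD f : scov n r f = scov n h f + scov n bz f + scov n s f.
    by rewrite rE !scovDl.
  have <- : scov n s s = scov n u u by rewrite scov_s scovC scov_s.
  rewrite rD [scov n h r]scovC [scov n bz r]scovC [scov n s r]scovC !rD.
  rewrite [scov n s h]scovC [scov n s bz]scovC [scov n bz h]scovC !scov_s.
  have -> : scov n h e = scov n h bz + scov n h u.
    by rewrite scovC scovDl ![scov n _ h]scovC.
  ring.
have sum_cst (p : nat) (x : R) : p%:R * x = \sum_(l < p) x.
  by rewrite sumr_const card_ord mulr_natl.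
have hbound : - (K%:R * (2 * m%:R ^+ 2 * B ^+ 2 + 2)) * rho <=
    scov n h h + 2 * scov n h e.
  rewrite scov_demeaned2 // scov_demeaned // /mean [2 * (n%:R^-1 * _)]mulrCA -mulrDr.
  have hE (i : 'I_n) : h i - n%:R^-1 * \sum_(i0 < n) h i0 =
      \sum_j gamma j * (c j i - mean n (c j)).
    rewrite -/(mean n h) /h mean_sum -sumrB; apply: eq_bigr => j _.
    by rewrite meanZ -mulrBr.
  have /(_ e) := oP gamma (fun i => h i - n%:R^-1 * \sum_(i0 < n) h i0) _ hE.
  have n1 : 0 <= (n%:R^-1 : R) by rewrite invr_ge0.
  move=> /(ler_wpM2l n1); apply: le_trans.
  rewrite mulrN mulNr lerN2 mulr_sumr.
  rewrite -[K%:R * _ * rho]mulrA [K%:R * _]sum_cst.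
  apply: ler_sum => l _.
  have -> : \sum_(i < n) o l i * e i =
      \sum_k b k * (\sum_(i < n) o l i * zc k i) + \sum_(i < n) o l i * u i.
    rewrite /e /bz; under eq_bigr do rewrite mulrDr mulr_sumr.
    rewrite big_split /= exchange_big /=; congr (_ + _).
    apply: eq_bigr => k _; rewrite mulr_sumr; apply: eq_bigr => i _.
    by rewrite mulrCA.
  set pz := fun k => \sum_(i < n) o l i * zc k i; set pu := \sum_(i < n) _.
  (* One factor [m] comes from Cauchy-Schwarz, the other from [m] terms of size at most
     [B ^+ 2 * rho]. *)
  have h1 : n%:R^-1 * (\sum_k b k * pz k) ^+ 2 <= m%:R * (m%:R * (B ^+ 2 * rho)).
    apply: le_trans (ler_wpM2l n1 (sqr_sum_le _)) _.
    rewrite mulrCA card_ord ler_wpM2l //.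
    rewrite [m%:R * (B ^+ 2 * rho)]sum_cst mulr_sumr.
    apply: ler_sum => k _; rewrite exprMn mulrCA ler_pM ?sqr_ge0 //.
    - by rewrite mulr_ge0 // sqr_ge0.
    - by rewrite -real_normK ?num_real // lerXn2r // nnegrE.
    - exact: oz.
  have h2 := ou l; rewrite -/pu in h2.
  have h3 : (\sum_k b k * pz k + pu) ^+ 2 <=
      2 * (\sum_k b k * pz k) ^+ 2 + 2 * pu ^+ 2.
    by have := sqr_ge0 (\sum_k b k * pz k - pu); rewrite sqrrB sqrrD; lra.
  apply: le_trans (ler_wpM2l n1 h3) _.
  rewrite mulrDr [n%:R^-1 * (2 * _)]mulrCA [n%:R^-1 * (2 * pu ^+ 2)]mulrCA.
  lra.
have bzbz : \sum_k \sum_l b k * b l * V k l - m%:R ^+ 2 * B ^+ 2 * rho <=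
    scov n bz bz.
  rewrite scov_suml lerBlDr.
  have -> : m%:R ^+ 2 * B ^+ 2 * rho = \sum_(k < m) \sum_(l < m) (B ^+ 2 * rho).
    rewrite !sumr_const !card_ord -[_ *+ m *+ m]mulr_natl -[_ *+ m]mulr_natl; ring.
  rewrite -big_split /=; apply: ler_sum => k _.
  rewrite scovZl scovC scov_suml mulr_sumr -big_split /=; apply: ler_sum => l _.
  rewrite scovZl mulrA -lerBlDl -mulrBr scovC.
  apply: le_trans (ler_norm _) _; rewrite normrM ler_pM // ?normr_ge0 //.
    by rewrite normrM expr2 ler_pM.
  by rewrite distrC.
have bzu : - (m%:R * B * rho) <= scov n bz u.
  rewrite scov_suml -mulrA [m%:R * _]sum_cst -sumrN.
  apply: ler_sum => k _; rewrite scovZl; apply: lerNnormlW.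
  by rewrite normrM ler_pM.
move: hbound bzbz bzu; lra.
Qed.

End FiniteSampleBound.

(** * Residuals of the model *)

Section Vectorization.
Context {R : realType}.

Lemma nth_allpairs_pair (S T : Type) (x0 : S) (y0 : T) (s : seq S) (t : seq T)
    i j : (i < size s)%N -> (j < size t)%N ->
  nth (x0, y0) [seq (x, y) | x <- s, y <- t] (i * size t + j) =
  (nth x0 s i, nth y0 t j).
Proof.
move=> + jt; elim: s i => [//|x s IHs] [|i] si.
  by rewrite allpairs_cons mul0n add0n nth_cat size_map jt (nth_map y0).
rewrite allpairs_cons nth_cat size_map mulSn -addnA ltnNge leq_addr /=.
by rewrite addnC addnK IHs.
Qed.

(** [mxvec_index] is a rank in the enumeration of pairs, which runs row by row. Its arithmetic value
    is what allows it to be matched with the Kronecker index. *)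
Lemma val_mxvec_index m n (i : 'I_m) (j : 'I_n) :
  (mxvec_index i j : nat) = (i * n + j)%N.
Proof.
have szij : (i * n + j < size (enum {: 'I_m * 'I_n}))%N.
  rewrite -cardE card_prod !card_ord.
  by rewrite (@leq_trans (i * n + n)) ?ltn_add2l // -mulSnr leq_mul2r ltn_ord orbT.
have szr : (enum_rank (i, j) < size (enum {: 'I_m * 'I_n}))%N.
  by rewrite -cardE.
apply/eqP; rewrite /= -(nth_uniq (i, j) szr szij (enum_uniq _)).
rewrite nth_enum_rank enumT unlock /= /prod_enum.
have := @nth_allpairs_pair _ _ i j (enum 'I_m) (enum 'I_n) i j.
by rewrite !size_enum_ord !nth_ord_enum => ->.
Qed.

Lemma mxtens_index_mxvec m n (i : 'I_m) (j : 'I_n) :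
  mxtens.mxtens_index (i, j) = mxvec_index i j.
Proof. by apply/ord_inj; rewrite val_mxvec_index. Qed.

Lemma unvecE m q (v : 'cV[R]_(q * m)) (k : 'I_m) (j : 'I_q) :
  unvec v k j = v (mxvec_index j k) 0.
Proof. by rewrite /unvec !mxE. Qed.

Lemma vecK m q : cancel (@vec R m q) (@unvec R m q).
Proof. by move=> A; rewrite /vec /unvec trmxK mxvecK trmxK. Qed.

(** Row [j] of the Kronecker product carries [z^T] in block [j] and zeros elsewhere, so only column
    [j] of the unstacked matrix survives. *)
Lemma Zmx_mul q m (z : 'cV[R]_m) (th : 'cV[R]_(q * m)) :
  Zmx q z *m th = (unvec th)^T *m z.
Proof.
apply/matrixP => j o; rewrite (ord1 o) !mxE.
rewrite (reindex _ (curry_mxvec_bij _ _)) /=.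
transitivity (\sum_(p : 'I_q * 'I_m) (j == p.1)%:R * (z p.2 0 * unvec th p.2 p.1)).
  apply: eq_bigr => -[j' k] _ /=; rewrite mulrA unvecE; congr (_ * _).
  rewrite /Zmx castmxE /= cast_ord_id -mxtens_index_mxvec.
  have -> : cast_ord (esym (muln1 q)) j = mxtens.mxtens_index (j, 0 : 'I_1).
    by apply/val_inj; rewrite /= muln1 addn0.
  by rewrite mxtens.tensmxE !mxE.
rewrite -(pair_bigA _ (fun j' k => (j == j')%:R * (z k 0 * unvec th k j'))) /=.
rewrite (bigD1 j) //= [X in _ + X]big1 ?addr0.
  by apply: eq_bigr => k _; rewrite eqxx mul1r mulrC !mxE.
by move=> j' /negbTE j'j; rewrite big1 // => k _; rewrite eq_sym j'j mul0r.
Qed.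

End Vectorization.

Section Residuals.
Context {R : realType}.
Variables K m q r : nat.
Implicit Types (psi : 'cV[R]_(K + (q * m + q * r))) (t : 'I_(q + r)).

(** The residual before demeaning, which is left to [scov]; intercepts therefore stay inside it. *)
Definition resid (y : nat -> 'cV[R]_(q + r)) (X : nat -> 'M[R]_(q + r, K))
    (z : nat -> 'cV[R]_m) psi t (i : nat) : R :=
  y i t 0 - (X i *m beta_of psi) t 0 -
  (Lambda_of psi *m ((Theta_of psi)^T *m z i)) t 0.

Lemma demeanE k l n (A : nat -> 'M[R]_(k, l)) i a b :
  demean n A i a b = A i a b - mean n (fun j => A j a b).
Proof. by rewrite /demean !mxE summxE. Qed.

Lemma demean_mulmxl k l p n (B : 'M[R]_(p, k)) (A : nat -> 'M[R]_(k, l)) i :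
  B *m demean n A i = demean n (fun j => B *m A j) i.
Proof. by rewrite /demean mulmxBr -scalemxAr mulmx_sumr. Qed.

Lemma demean_mulmxr k l p n (A : nat -> 'M[R]_(k, l)) (B : 'M[R]_(l, p)) i :
  demean n A i *m B = demean n (fun j => A j *m B) i.
Proof. by rewrite /demean mulmxBl -scalemxAl mulmx_suml. Qed.

(** Demeaning commutes with multiplication by constant matrices, so each demeaned residual is
    [resid] minus its sample mean, and its mean square is a sample variance. *)
Lemma nlsE n y X z psi : (0 < n)%N ->
  nls n y X z psi =
  2^-1 * \sum_t scov n (resid y X z psi t) (resid y X z psi t).
Proof.
move=> n0; rewrite /nls invfM -mulrA; congr (_ * _).
under [RHS]eq_bigr do rewrite scov_demeaned2 //.
rewrite -mean_sum; congr (_ * _); apply: eq_bigr => i _.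
rewrite mxE; apply: eq_bigr => t _; rewrite mxE -expr2; congr (_ ^+ 2).
rewrite demean_mulmxl !demean_mulmxr.
have entryB (A B C : 'cV[R]_(q + r)) : (A - B - C) t 0 = A t 0 - B t 0 - C t 0.
  by rewrite !mxE.
rewrite entryB !demeanE.
under [X in _ - (_ - X) = _]eq_mean do rewrite -mulmxA Zmx_mul.
rewrite -mulmxA Zmx_mul.
have -> : mean n (resid y X z psi t) =
    mean n (fun j => y j t 0) - mean n (fun j => (X j *m beta_of psi) t 0) -
    mean n (fun j => (Lambda_of psi *m ((Theta_of psi)^T *m z j)) t 0).
  by rewrite /mean -!mulrBr -!sumrB.
by rewrite /resid; ring.
Qed.

End Residuals.

Section ResidualDecomposition.
Context {R : realType}.
Variables K m q r : nat.
Implicit Types (psi : 'cV[R]_(K + (q * m + q * r))) (t : 'I_(q + r)).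

(** The second summand of [pi_t]. *)
Definition Theta_row psi t : 'cV[R]_m :=
  Theta_of psi *m (row t (Lambda_of psi))^T.

Lemma Lambda_Theta_mul psi t (z : 'cV[R]_m) :
  (Lambda_of psi *m ((Theta_of psi)^T *m z)) t 0 =
  \sum_k Theta_row psi t k 0 * z k 0.
Proof.
rewrite mulmxA mxE; apply: eq_bigr => k _; congr (_ * _).
by rewrite !mxE; apply: eq_bigr => j _; rewrite !mxE mulrC.
Qed.

(** Once the regressors are written through [c] and the centered [z], the coefficient of the
    centered [z] in the fit is [pi_t]; the rest of the [Theta_row] term multiplies [mu] and is
    constant in [i]. *)
Lemma resid_decomposition (y : nat -> 'cV[R]_(q + r))
    (X : nat -> 'M[R]_(q + r, K)) (z : nat -> 'cV[R]_m)
    (Sm : 'I_(q + r) -> 'M[R]_(m, K)) psi psi0 t i (c : 'I_K -> R)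
    (mu : 'I_m -> R) :
  (forall j, X i t j = c j + \sum_k Sm t k j * (z i k 0 - mu k)) ->
  resid y X z psi t i =
  \sum_j (beta_of psi0 j 0 - beta_of psi j 0) * c j +
  \sum_k (pi_t Sm t psi0 k 0 - pi_t Sm t psi k 0) * (z i k 0 - mu k) +
  (\sum_k (Theta_row psi0 t k 0 - Theta_row psi t k 0) * mu k +
   resid y X z psi0 t i).
Proof.
move=> Xc; rewrite /resid !Lambda_Theta_mul.
have XbE psi' : (X i *m beta_of psi') t 0 = \sum_j beta_of psi' j 0 * c j +
    \sum_k (pi_t Sm t psi' k 0 - Theta_row psi' t k 0) * (z i k 0 - mu k).
  rewrite mxE; under eq_bigr do rewrite Xc mulrDl mulrC.
  rewrite big_split /=; congr (_ + _).
  under eq_bigr do rewrite mulr_suml.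
  rewrite exchange_big /=; apply: eq_bigr => k _.
  rewrite /pi_t mxE -/(Theta_row _ _) addrK mxE mulr_suml.
  by apply: eq_bigr => j _; rewrite mulrAC.
have sumB (I : finType) (f g h : I -> R) :
    \sum_i (f i - g i) * h i = \sum_i f i * h i - \sum_i g i * h i.
  by rewrite -sumrB; apply: eq_bigr => ? _; rewrite mulrBl.
have sumBr (I : finType) (f g h : I -> R) :
    \sum_i f i * (g i - h i) = \sum_i f i * g i - \sum_i f i * h i.
  by rewrite -sumrB; apply: eq_bigr => ? _; rewrite mulrBr.
rewrite !XbE !sumB !sumBr; ring.
Qed.

Lemma pack_beta (beta : 'cV[R]_K) (Theta : 'M[R]_(m, q)) (L2 : 'M[R]_(r, q)) :
  beta_of (pack beta Theta L2) = beta.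
Proof. by rewrite /beta_of /pack col_mxKu. Qed.

Lemma pack_Theta (beta : 'cV[R]_K) (Theta : 'M[R]_(m, q)) (L2 : 'M[R]_(r, q)) :
  Theta_of (pack beta Theta L2) = Theta.
Proof. by rewrite /Theta_of /theta_of /pack col_mxKd col_mxKu vecK. Qed.

Lemma pack_Lambda (beta : 'cV[R]_K) (Theta : 'M[R]_(m, q)) (L2 : 'M[R]_(r, q)) :
  Lambda_of (pack beta Theta L2) = Lambda L2.
Proof. by rewrite /Lambda_of /pack !col_mxKd vecK. Qed.

Lemma Lambda_normalized (Phi : 'M[R]_(q + r, q)) : usubmx Phi \in unitmx ->
  Lambda (dsubmx Phi *m invmx (usubmx Phi)) *m usubmx Phi = Phi.
Proof.
by move=> uPhi; rewrite /Lambda mul_col_mx mul1mx mulmxKV // vsubmxK.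
Qed.

End ResidualDecomposition.

(** * Continuity of the objective in the parameter *)

Section Continuity.
Context {R : realType}.

Lemma continuous_sum (T : topologicalType) (I : Type) (s : seq I)
    (F : I -> T -> R) :
  (forall i, continuous (F i)) -> continuous (fun x => \sum_(i <- s) F i x).
Proof.
move=> cF; elim: s => [|i s IHs] x.
  by under eq_fun do rewrite big_nil; exact: cst_continuous.
under eq_fun do rewrite big_cons; exact: (continuousD (cF i x) (IHs x)).
Qed.

Lemma continuous_mul (T : topologicalType) (f g : T -> R) :
  continuous f -> continuous g -> continuous (fun x => f x * g x).
Proof. by move=> cf cg x; exact: (continuousM (cf x) (cg x)). Qed.

Lemma continuous_sub (T : topologicalType) (f g : T -> R) :
  continuous f -> continuous g -> continuous (fun x => f x - g x).
Proof. by move=> cf cg x; exact: (continuousB (cf x) (cg x)). Qed.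

Lemma continuous_add (T : topologicalType) (f g : T -> R) :
  continuous f -> continuous g -> continuous (fun x => f x + g x).
Proof. by move=> cf cg x; exact: (continuousD (cf x) (cg x)). Qed.

Lemma continuous_const (T : topologicalType) (a : R) :
  continuous (fun _ : T => a).
Proof. by move=> x; exact: cst_continuous. Qed.

Lemma continuous_scov (T : topologicalType) n (f g : T -> nat -> R) :
  (forall i, continuous (f^~ i)) -> (forall i, continuous (g^~ i)) ->
  continuous (fun x => scov n (f x) (g x)).
Proof.
move=> cf cg; rewrite /scov /mean; apply: continuous_sub.
  apply: continuous_mul; first exact: continuous_const.
  by apply: continuous_sum => i; exact: continuous_mul.
by apply: continuous_mul; apply: continuous_mul;
  (exact: continuous_const || exact: continuous_sum).
Qed.

Variables K m q r : nat.
Let V := 'cV[R]_(K + (q * m + q * r)).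

Lemma continuous_beta j : continuous (fun psi : V => beta_of psi j 0).
Proof.
under eq_fun do rewrite mxE; exact: coord_continuous.
Qed.

Lemma continuous_Theta k j : continuous (fun psi : V => Theta_of psi k j).
Proof.
under eq_fun do rewrite unvecE !mxE; exact: coord_continuous.
Qed.

Lemma continuous_Lambda t j : continuous (fun psi : V => Lambda_of psi t j).
Proof.
rewrite /Lambda_of /Lambda; case: (split_ordP t) => t' ->.
  under eq_fun do rewrite col_mxEu; exact: continuous_const.
under eq_fun do rewrite col_mxEd unvecE !mxE; exact: coord_continuous.
Qed.

Lemma continuous_Theta_row t k : continuous (fun psi : V => Theta_row psi t k 0).
Proof.
under eq_fun do rewrite mxE; apply: continuous_sum => j.
under eq_fun do rewrite [_^T j 0]mxE [row _ _ _ _]mxE; apply: continuous_mul.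
  exact: continuous_Theta.
exact: continuous_Lambda.
Qed.

Lemma continuous_pi Sm t k : continuous (fun psi : V => pi_t Sm t psi k 0).
Proof.
under eq_fun do rewrite mxE; apply: continuous_add.
  under eq_fun do rewrite mxE; apply: continuous_sum => j.
  by apply: continuous_mul; [exact: continuous_const|exact: continuous_beta].
exact: continuous_Theta_row.
Qed.

Lemma continuous_resid y X z t i :
  continuous (fun psi : V => resid y X z psi t i).
Proof.
apply: continuous_sub.
  apply: continuous_sub; first exact: continuous_const.
  under eq_fun do rewrite mxE; apply: continuous_sum => j.
  by apply: continuous_mul; [exact: continuous_const|exact: continuous_beta].
under eq_fun do rewrite Lambda_Theta_mul; apply: continuous_sum => k.
by apply: continuous_mul; [exact: continuous_Theta_row|exact: continuous_const].
Qed.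

Lemma continuous_nls n y X z : (0 < n)%N ->
  continuous (fun psi : V => nls n y X z psi).
Proof.
move=> n0; under eq_fun do rewrite nlsE //.
apply: continuous_mul; first exact: continuous_const.
apply: continuous_sum => t; apply: continuous_scov => i; exact: continuous_resid.
Qed.

End Continuity.

(** * Measurability of the objective, and functions of i.i.d. vectors *)

Section Measurability.
Context {d : measure_display} {Omega : measurableType d} {R : realType}.

Lemma random_mxD k l (A B : Omega -> 'M[R]_(k, l)) :
  random_mx A -> random_mx B -> random_mx (fun w => A w + B w).
Proof.
move=> mA mB i j; under eq_fun do rewrite mxE; exact: measurable_funD.
Qed.

Lemma random_mx_cst k l (A : 'M[R]_(k, l)) :
  random_mx (fun _ : Omega => A).
Proof. by move=> i j; exact: measurable_cst. Qed.

Lemma random_mxM k l p (A : Omega -> 'M[R]_(k, l)) (B : Omega -> 'M[R]_(l, p)) :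
  random_mx A -> random_mx B -> random_mx (fun w => A w *m B w).
Proof.
move=> mA mB i j; under eq_fun do rewrite mxE.
by apply: measurable_sum => h; exact: measurable_funM.
Qed.

Lemma measurable_scov n (f g : Omega -> nat -> R) :
  (forall i, measurable_fun [set: Omega] (f^~ i)) ->
  (forall i, measurable_fun [set: Omega] (g^~ i)) ->
  measurable_fun [set: Omega] (fun w => scov n (f w) (g w)).
Proof.
move=> mf mg; rewrite /scov /mean; apply: measurable_funB.
  apply: measurable_funM; first exact: measurable_cst.
  by apply: measurable_sum => i; exact: measurable_funM.
by apply: measurable_funM; apply: measurable_funM;
  (exact: measurable_cst || exact: measurable_sum).
Qed.

Lemma measurable_nls K m q r n
    (y : nat -> Omega -> 'cV[R]_(q + r)) (X : nat -> Omega -> 'M[R]_(q + r, K))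
    (z : nat -> Omega -> 'cV[R]_m) (psi : 'cV[R]_(K + (q * m + q * r))) :
  (0 < n)%N -> (forall i, random_mx (y i)) -> (forall i, random_mx (X i)) ->
  (forall i, random_mx (z i)) ->
  measurable_fun [set: Omega]
    (fun w => nls n (y^~ w) (X^~ w) (z^~ w) psi).
Proof.
move=> n0 my mX mz; under eq_fun do rewrite nlsE //.
apply: measurable_funM; first exact: measurable_cst.
apply: measurable_sum => t.
suff mr i : measurable_fun [set: Omega]
    (fun w => resid (y^~ w) (X^~ w) (z^~ w) psi t i) by exact: measurable_scov.
apply: measurable_funB; last first.
  by do 2 ! [apply: random_mxM; first exact: random_mx_cst]; exact: mz.
apply: measurable_funB; first exact: my.
by apply: random_mxM; [exact: mX|exact: random_mx_cst].
Qed.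

(** The generators of [borel_cV]. Naming them lets [borelT] carry that sigma-algebra as a measurable
    type, so that measurable functions of the vectors [v i] can be composed. *)
Definition coord_sets k : set (set 'cV[R]_k) :=
  \big[setU/set0]_(i < k)
    preimage_set_system setT (fun v : 'cV[R]_k => v i 0) measurable.

Definition borelT k := g_sigma_algebraType (@coord_sets k).

Lemma measurable_coord k (i : 'I_k) :
  measurable_fun [set: borelT k] (fun v : borelT k => (v : 'cV[R]_k) i 0).
Proof.
move=> _ A mA; apply: sub_sigma_algebra.
by rewrite /coord_sets (bigD1 i) //=; left; exists A.
Qed.

Lemma random_mx_measurable k (U : Omega -> 'cV[R]_k) :
  random_mx U -> measurable_fun [set: Omega] (U : Omega -> borelT k).
Proof.
move=> mU.
have E : @measurable _ (borelT k) = <<s @coord_sets k >> by [].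
apply: (measurability _ E).
move=> _ [C + <-]; rewrite /coord_sets; elim/big_rec: _ => [//|i S _ IH].
by move=> [[A mA <-]|/IH //]; rewrite setTI; apply: mU.
Qed.

Lemma iid_pairwise_iid (P : probability Omega R) k
    (V : nat -> Omega -> 'cV[R]_k) (f : borelT k -> R) :
  iid P V -> measurable_fun [set: borelT k] f ->
  pairwise_iid P (fun i w => f (V i w)).
Proof.
move=> [mV indV idV] mf.
have bf A : measurable A -> borel_cV (f @^-1` A).
  by move=> mA; rewrite -[X in borel_cV X]setTI; exact: mf.
split=> [i|i j A B ij mA mB|i A mA].
- exact: (measurableT_comp mf (random_mx_measurable (mV i))).
- have ji : (j == i) = false by rewrite eq_sym; exact: negbTE.
  (* Mutual independence is applied to a two-element index list; only the values at [i] and [j]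
     matter. *)
  have := indV [:: i; j] (fun l => if l == i then f @^-1` A else f @^-1` B).
  rewrite /= inE ij !big_cons big_nil eqxx ji mule1 => <- //; last first.
    by move=> l; case: ifP => _; exact: bf.
  congr (P _); apply/seteqP; split => w /=.
    by move=> [Aw Bw] l; rewrite /= !inE => /orP[]/eqP ->; rewrite ?eqxx ?ji.
  move=> H; split.
    by have := H i; rewrite /= !inE eqxx => /(_ isT).
  by have := H j; rewrite /= !inE eqxx orbT ji => /(_ isT).
- exact: (idV i 0%N _ (bf _ mA)).
Qed.

End Measurability.

(** * Consistency *)

Section Projection.
Context {d : measure_display} {Omega : measurableType d} {R : realType}.
Variable P : probability Omega R.

Lemma quadratic_formE k (A : 'M[R]_k) (c : 'cV[R]_k) :
  (c^T *m A *m c) 0 0 = \sum_i \sum_j c i 0 * c j 0 * A i j.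
Proof.
rewrite mxE exchange_big /=; apply: eq_bigr => j _.
rewrite mxE mulr_suml; apply: eq_bigr => i _.
by rewrite mxE mulrAC.
Qed.

(** A nonzero row of the kernel would make the quadratic form vanish. *)
Lemma posdef_unitmx k (A : 'M[R]_k) : posdef A -> A \in unitmx.
Proof.
move=> [_ pA]; rewrite -row_free_unit -kermx_eq0.
apply/eqP/row_matrixP => i; rewrite row0; apply/eqP/negPn/negP => u0.
have uA : row i (kermx A) *m A = 0 by rewrite -row_mul mulmx_ker row0.
have := pA (row i (kermx A))^T; rewrite trmx_eq0 => /(_ u0).
by rewrite trmxK uA mul0mx mxE ltxx.
Qed.

Lemma covariance_Ex (X Y : Omega -> R) :
  fine (covariance P X Y) = Ex P (fun w => (X w - Ex P X) * (Y w - Ex P Y)).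
Proof. by rewrite unlock. Qed.

Variables (m q : nat) (z : Omega -> 'cV[R]_m) (eta : Omega -> 'cV[R]_q).
Hypothesis sz : forall k, sqintg P (fun w => z w k 0).
Hypothesis seta : forall j, sqintg P (fun w => eta w j 0).
Hypothesis eta_mean : forall j, Ex P (fun w => eta w j 0) = 0.
Hypothesis Vunit : Var P z \in unitmx.

Let Theta := proj_slope P z eta.
Let zc k w := z w k 0 - Emx P z k 0.
Let err w := eta w - proj_intercept P z eta - Theta^T *m z w.

Lemma sqintg_centered k : sqintg P (zc k).
Proof. by apply: sqintgD => //; exact: sqintg_cst. Qed.

Lemma Ex_centered k : Ex P (zc k) = 0.
Proof.
rewrite ExD ?Ex_cst ?mxE ?subrr //; last exact: intg_cst.
exact: sqintg_intg.
Qed.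

(** The intercept only recenters [z] at its mean. *)
Lemma projection_errorE j w : err w j 0 = eta w j 0 - \sum_k Theta k j * zc k w.
Proof.
rewrite /err /proj_intercept opprK -/Theta !mxE -addrA; congr (_ + _).
rewrite -sumrB -sumrN.
by apply: eq_bigr => k _; rewrite /zc !mxE; ring.
Qed.

Let sum_centered j : sqintg P (fun w => \sum_k Theta k j * zc k w).
Proof. by apply: sqintg_sum => k; apply: sqintgZ; exact: sqintg_centered. Qed.

Lemma Ex_projection_error j : Ex P (fun w => err w j 0) = 0.
Proof.
under eq_fun do rewrite projection_errorE -mulN1r.
rewrite ExD ?ExZ ?Ex_sum ?eta_mean //; try exact: sqintg_intg.
- rewrite big1 ?mulr0 ?addr0 // => k _.
  by rewrite ExZ ?Ex_centered ?mulr0 //; apply: sqintg_intg; exact: sqintg_centered.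
- by move=> k; apply: intgZ; apply: sqintg_intg; exact: sqintg_centered.
- by apply: intgZ; exact: sqintg_intg.
Qed.

(** These are the normal equations [Var P z *m Theta = Cov P z eta], read entry by entry. *)
Lemma projection_error_uncorrelated k j :
  Ex P (fun w => zc k w * err w j 0) = 0.
Proof.
have izz l : intg P (fun w => zc k w * zc l w).
  by apply: sqintgM; exact: sqintg_centered.
have ize : intg P (fun w => zc k w * eta w j 0).
  by apply: sqintgM => //; exact: sqintg_centered.
under eq_fun => w.
  rewrite projection_errorE mulrBr mulr_sumr.
  under eq_bigr => l _ do rewrite mulrCA.
  rewrite -mulN1r; over.
have is1 : intg P (fun w => \sum_l Theta l j * (zc k w * zc l w)).
  by apply: intg_sum => l; exact: intgZ.
rewrite ExD ?ExZ //; last exact: intgZ.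
rewrite Ex_sum; last by move=> l; exact: intgZ.
have VT : Var P z *m Theta = Cov P z eta by rewrite /Theta /proj_slope mulKVmx.
have := congr1 (fun M : 'M[R]_(m, q) => M k j) VT.
rewrite mxE [Cov P z eta k j]mxE covariance_Ex eta_mean.
under [X in _ = Ex _ X]eq_fun do rewrite subr0.
have -> : Ex P (fun w => zc k w * eta w j 0) =
  Ex P (fun w => (z w k 0 - Ex P (fun w => z w k 0)) * eta w j 0).
  by congr Ex; apply/funext => w; rewrite /zc mxE.
move=> <-; apply/eqP; rewrite mulN1r subr_eq0; apply/eqP.
apply: eq_bigr => l _; rewrite ExZ // mulrC [Var P z k l]mxE covariance_Ex.
by congr (_ * Ex _ _); apply/funext => w; rewrite /zc !mxE.
Qed.

End Projection.

(** The normalized loadings times the top block of [Phi0] give back [Phi0], so the factor term is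
    [Lambda L2] applied to the normalized factors. Subtracting their fitted part leaves a constant,
    the projection error and [e]. *)
Lemma resid_at_truth (R : realType) K m q r (y : nat -> 'cV[R]_(q + r))
    (X : nat -> 'M[R]_(q + r, K)) (z : nat -> 'cV[R]_m)
    (beta0 : 'cV[R]_K) (delta0 e : 'cV[R]_(q + r)) (Phi0 : 'M[R]_(q + r, q))
    (Theta0 : 'M[R]_(m, q)) (mu0 etat : 'cV[R]_q) t i :
  usubmx Phi0 \in unitmx ->
  y i = X i *m beta0 + delta0 + Phi0 *m etat + e ->
  let L2 := dsubmx Phi0 *m invmx (usubmx Phi0) in
  resid y X z (pack beta0 Theta0 L2) t i =
  (delta0 t 0 + (Lambda L2 *m mu0) t 0) +
  ((Lambda L2 *m (usubmx Phi0 *m etat - mu0 - Theta0^T *m z i)) t 0 + e t 0).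
Proof.
move=> uPhi yE L2; rewrite /resid pack_beta pack_Theta pack_Lambda yE.
have LN := Lambda_normalized uPhi; rewrite -/L2 in LN.
rewrite !mulmxBr [Lambda L2 *m (usubmx Phi0 *m _)]mulmxA LN.
have entryD (A B C D : 'cV[R]_(q + r)) :
    (A + B + C + D) t 0 = A t 0 + B t 0 + C t 0 + D t 0 by rewrite !mxE.
have entryB (A B C : 'cV[R]_(q + r)) : (A - B - C) t 0 = A t 0 - B t 0 - C t 0.
  by rewrite !mxE.
rewrite entryD entryB; ring.
Qed.

(** One bound serves the whole family: the sum of squares attains its maximum, and
    [|x| <= 1 + x ^+ 2]. *)
Lemma compact_family_bound (R : realType) (T : topologicalType) (I : finType)
    (A : set T) (f : I -> T -> R) :
  compact A -> (forall i, continuous (f i)) ->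
  exists2 B, 0 <= B & forall i x, A x -> `|f i x| <= B.
Proof.
move=> cA cf; have [->|/set0P A0] := eqVneq A set0; first by exists 0.
pose G x := - \sum_i f i x ^+ 2.
have cG : continuous G.
  move=> x; apply: continuousN; apply: continuous_sum => i.
  by under eq_fun do rewrite expr2; exact: continuous_mul.
have [c Ac cmin] := compact_argmin A0 cA cG.
have S0 x (P : pred I) : 0 <= \sum_(i | P i) f i x ^+ 2.
  by apply: sumr_ge0 => i _; exact: sqr_ge0.
exists (1 + \sum_i f i c ^+ 2); first by rewrite addr_ge0.
move=> i x Ax; have := cmin x Ax; rewrite /G lerN2 (bigD1 i) //= => h.
have := S0 x (predC1 i); rewrite /= => h'.
have := sqr_ge0 (`|f i x| - 1); rewrite sqrrB real_normK ?num_real // => h2.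
have := normr_ge0 (f i x); lra.
Qed.

Lemma compact_positive_min (R : realType) (T : topologicalType)
    (A : set T) (f : T -> R) :
  compact A -> continuous f -> (forall x, A x -> 0 < f x) ->
  exists2 e, 0 < e & forall x, A x -> e <= f x.
Proof.
move=> cA cf f0; have [->|/set0P A0] := eqVneq A set0; first by exists 1.
by have [c Ac cmin] := compact_argmin A0 cA cf; exists (f c) => //; exact: f0.
Qed.

Lemma probability_cvg0 (d : measure_display) (Omega : measurableType d)
    (R : realType) (P : probability Omega R) (S : nat -> set Omega) :
  (forall n, measurable (S n)) ->
  (forall delta : R, 0 < delta ->
     exists N, forall n, (N <= n)%N -> (P (S n) <= delta%:E)%E) ->
  P (S n) @[n --> \oo] --> 0%E.
Proof.
move=> mS H; apply/fine_cvgP; split.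
  by apply: nearW => n; exact: fin_num_measure.
apply/cvgrPdist_le => e e0; have [N NP] := H e e0.
exists N => // n /= Nn; rewrite sub0r normrN ger0_norm ?fine_ge0 //.
by rewrite -lee_fin fineK ?fin_num_measure //; exact: NP.
Qed.

Lemma spans_regressors_off_null (d : measure_display) (Omega : measurableType d)
    (R : realType) (P : probability Omega R) K m q r
    (Sm : 'I_(q + r) -> 'M[R]_(m, K)) X z :
  spans_regressors P Sm X z ->
  exists N, [/\ measurable N, P N = 0%E & forall w, ~ N w -> forall i t,
    (row t (X i w))^T - Emx P (fun w' => (row t (X i w'))^T) =
    (Sm t)^T *m (z i w - Emx P (z i))].
Proof.
move=> span.
(* Countable intersection of almost sure events is over [nat], so periods are indexed by [k : nat];
   values [k >= q + r] are vacuous. *)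
have : {ae P, forall w, forall i k t, k = val t ->
    (row t (X i w))^T - Emx P (fun w' => (row t (X i w'))^T) =
    (Sm t)^T *m (z i w - Emx P (z i))}.
  apply: ae_foralln => i; apply: ae_foralln => k.
  have [kT|kT] := ltnP k (q + r).
    apply: filterS (span i (Ordinal kT)) => w h t kt.
    by rewrite (_ : t = Ordinal kT) //; exact/val_inj.
  apply: aeW => w t kt; move: (ltn_ord t); by rewrite -[(t < _)%N]/(val t < _)%N -kt ltnNge kT.
move=> [N [mN PN subN]]; exists N; split=> // w Nw i t.
apply/not_notP => bad; apply: Nw; apply: subN => /= /(_ i _ t erefl).
exact: bad.
Qed.

Lemma smallp_scov (d : measure_display) (Omega : measurableType d)
    (R : realType) (P : probability Omega R) (Y Z : nat -> Omega -> R) (c : R) :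
  smallp P (fun n w => n%:R^-1 * \sum_(i < n) Y i w * Z i w - c) ->
  smallp P (fun n w => n%:R^-1 * \sum_(i < n) Y i w) ->
  smallp P (fun n w => n%:R^-1 * \sum_(i < n) Z i w) ->
  smallp P (fun n w => scov n (Y^~ w) (Z^~ w) - c).
Proof.
move=> hYZ hY hZ; have hM := smallpM hY hZ.
have hN : smallp P (fun n w => - ((n%:R^-1 * \sum_(i < n) Y i w) *
    (n%:R^-1 * \sum_(i < n) Z i w))).
  by apply: smallp_le hM _ => n w _; rewrite normrN.
apply: smallp_le (smallpD hYZ hN) _ => n w _.
by rewrite /scov /mean addrAC.
Qed.

Lemma le_sum_norm (R : realType) (I : finType) (F : I -> R) i :
  `|F i| <= \sum_j `|F j|.
Proof. by rewrite (bigD1 i) //= lerDl sumr_ge0. Qed.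

Theorem theorem1 (R : realType) (d : measure_display)
    (Omega : measurableType d) (P : probability Omega R)
    (K m q r : nat) (q_gt0 : (0 < q)%N) (r_gt0 : (0 < r)%N)
    (beta0 : 'cV[R]_K) (delta0 : 'cV[R]_(q + r)) (Phi0 : 'M[R]_(q + r, q))
    (X : nat -> Omega -> 'M[R]_(q + r, K))
    (etat : nat -> Omega -> 'cV[R]_q)
    (eps : nat -> Omega -> 'cV[R]_(q + r))
    (sel : 'I_m -> 'I_(q + r) * 'I_K)
    (Sm : 'I_(q + r) -> 'M[R]_(m, K))
    (Psi Psibar : set 'cV[R]_(K + (q * m + q * r))) :
  let y := outcome beta0 delta0 Phi0 X etat eps in
  let z := selected sel X in
  let eta := fun i w => usubmx Phi0 *m etat i w in
  let Theta0 := proj_slope P (z 0%N) (eta 0%N) in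
  let mu0 := proj_intercept P (z 0%N) (eta 0%N) in
  let a := fun i w => eta i w - mu0 - Theta0^T *m z i w in
  let v := fun i w => col_mx (z i w) (col_mx (a i w) (eps i w)) in
  let psi0 := pack beta0 Theta0 (dsubmx Phi0 *m invmx (usubmx Phi0)) in
  let Sn := fun n w =>
    nls n (fun i => y i w) (fun i => X i w) (fun i => z i w) in
  (forall i, random_mx (X i)) ->
  (forall i, random_mx (etat i)) ->
  (forall i, random_mx (eps i)) ->
  (forall i j, (fun w => etat i w j 0) \in Lfun P 1 /\
               ('E_P[fun w => etat i w j 0%R] = 0)%E) ->
  errors_cond_mean_zero P delta0 Phi0 X etat eps ->
  usubmx Phi0 \in unitmx ->
  injective sel ->
  (forall i, Emx P (fun w => z i w *m (z i w)^T) \in unitmx) ->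
  spans_regressors P Sm X z ->
  Psi psi0 ->
  (* (A1) *) iid P v ->
  (* (A2) *) (forall i k, (fun w => v i w k 0) \in Lfun P 2%:E) ->
  (* (A3) *) (forall k t,
     ('E_P[fun w => (z 0%N w k 0 * eps 0%N w t 0)%R] = 0)%E) ->
  (* (A4) *) posdef (Var P (z 0%N)) ->
  (* (A5) *) (forall psi, Psi psi -> psi <> psi0 ->
                exists t, pi_t Sm t psi <> pi_t Sm t psi0) ->
  compact Psibar ->
  Psibar `<=` Psi ->
  Psibar° psi0 ->
  exists psihat : nat -> Omega -> 'cV[R]_(K + (q * m + q * r)),
    (forall n, (0 < n)%N ->
       random_mx (psihat n) /\
       forall w, Psibar (psihat n w) /\
         forall psi, Psibar psi -> Sn n w (psihat n w) <= Sn n w psi) /\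
    cvg_in_probability P psihat psi0.
Proof.
move=> y z eta Theta0 mu0 a v psi0 Sn mX meta meps Eeta Ceps uPhi _ _ span _.
move=> iidv L2v Ezeps pdV ident cpt sub /interior_subset psi0in.

(* Measurability and second moments in the model *)
have mz i : random_mx (z i).
  by move=> k j; under eq_fun do rewrite mxE; exact: mX.
have my i : random_mx (y i).
  apply: random_mxD; last exact: meps.
  apply: random_mxD; last by apply: random_mxM; [exact: random_mx_cst|exact: meta].
  apply: random_mxD; last exact: random_mx_cst.
  by apply: random_mxM; [exact: mX|exact: random_mx_cst].
have sz i k : sqintg P (fun w => z i w k 0).
  apply: Lfun2_sqintg.
  have -> : (fun w => z i w k 0) = (fun w => v i w (lshift _ k) 0).
    by apply/funext => w; rewrite /v col_mxEu.
  exact: L2v.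
have sa i j : sqintg P (fun w => a i w j 0).
  apply: Lfun2_sqintg.
  have -> : (fun w => a i w j 0) =
      (fun w => v i w (rshift m (lshift (q + r) j)) 0).
    by apply/funext => w; rewrite /v col_mxEd col_mxEu.
  exact: L2v.
have se i t : sqintg P (fun w => eps i w t 0).
  apply: Lfun2_sqintg.
  have -> : (fun w => eps i w t 0) = (fun w => v i w (rshift m (rshift q t)) 0).
    by apply/funext => w; rewrite /v !col_mxEd.
  exact: L2v.
(* The second moments of [eta] follow from those of [a] and [z] by solving the definition of [a] for
   [eta]. *)
have seta j : sqintg P (fun w => eta 0%N w j 0).
  have -> : (fun w => eta 0%N w j 0) =
      (fun w => a 0%N w j 0 + (mu0 j 0 + \sum_k Theta0 k j * z 0%N w k 0)).
    apply/funext => w.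
    have entryB (A B C : 'cV[R]_q) : (A - B - C) j 0 = A j 0 - B j 0 - C j 0.
      by rewrite !mxE.
    have trE (A : 'M[R]_(m, q)) x : (A^T *m x) j 0 = \sum_k A k j * x k 0.
      by rewrite mxE; apply: eq_bigr => k _; rewrite mxE.
    by rewrite /a entryB trE; ring.
  apply: sqintgD => //; apply: sqintgD; first exact: sqintg_cst.
  by apply: sqintg_sum => k; exact: sqintgZ.
have eta_mean j : Ex P (fun w => eta 0%N w j 0) = 0.
  under eq_fun do rewrite mxE.
  have ietat k : intg P (fun w => etat 0%N w k 0) by case: (Eeta 0%N k).
  rewrite Ex_sum; last by move=> k; exact: intgZ.
  rewrite big1 // => k _; rewrite ExZ // /Ex.
  by have [_ ->] := Eeta 0%N k; rewrite mulr0.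
have Vunit := posdef_unitmx pdV.
pose mu k := Emx P (z 0%N) k 0.
pose L0 := Lambda (dsubmx Phi0 *m invmx (usubmx Phi0)).
pose zc k i w := z i w k 0 - mu k.
pose u t i w := (L0 *m a i w) t 0 + eps i w t 0.
pose V k l := Var P (z 0%N) k l.
have szc k i : sqintg P (zc k i) by apply: sqintgD => //; exact: sqintg_cst.
have uE t i w : u t i w = \sum_j L0 t j * a i w j 0 + eps i w t 0.
  by rewrite /u mxE.
have su t i : sqintg P (u t i).
  rewrite (funext (uE t i)).
  by apply: sqintgD => //; apply: sqintg_sum => j; exact: sqintgZ.
(* Each variable is a fixed measurable function of [v i], from which it inherits the i.i.d.
   property. *)
have [pz pu pzz pzu] : [/\ forall k, pairwise_iid P (zc k),
    forall t, pairwise_iid P (u t),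
    forall k l, pairwise_iid P (fun i w => zc k i w * zc l i w)
    & forall k t, pairwise_iid P (fun i w => zc k i w * u t i w)].
  pose zcf k (x : @borelT R (m + (q + (q + r)))) : R :=
    (x : 'cV[R]_(m + (q + (q + r)))) (lshift _ k) 0 - mu k.
  pose uf t (x : @borelT R (m + (q + (q + r)))) : R :=
    \sum_j L0 t j * (x : 'cV[R]_(m + (q + (q + r)))) (rshift m (lshift (q + r) j)) 0
    + (x : 'cV[R]_(m + (q + (q + r)))) (rshift m (rshift q t)) 0.
  have mzcf k : measurable_fun setT (zcf k).
    by apply: measurable_funB; [exact: measurable_coord|exact: measurable_cst].
  have muf t : measurable_fun setT (uf t).
    apply: measurable_funD; last exact: measurable_coord.
    apply: measurable_sum => j; apply: measurable_funM; first exact: measurable_cst.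
    exact: measurable_coord.
  have zcE k : zc k = fun i w => zcf k (v i w).
    by apply/funext => i; apply/funext => w; rewrite /zcf /v col_mxEu.
  have ufE t : u t = fun i w => uf t (v i w).
    apply/funext => i; apply/funext => w; rewrite uE /uf /v !col_mxEd.
    by congr (_ + _); apply: eq_bigr => j _; rewrite col_mxEd col_mxEu.
  split=> [k|t|k l|k t].
  - by rewrite zcE; exact: iid_pairwise_iid iidv (mzcf k).
  - by rewrite ufE; exact: iid_pairwise_iid iidv (muf t).
  - rewrite !zcE; apply: (@iid_pairwise_iid _ _ _ P _ v (fun x => zcf k x * zcf l x)) => //.
    exact: measurable_funM.
  - rewrite zcE ufE; apply: (@iid_pairwise_iid _ _ _ P _ v (fun x => zcf k x * uf t x)) => //.
    exact: measurable_funM.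

(* Moment conditions on [zc] and the composite error [u] *)
have Ezc k : Ex P (zc k 0%N) = 0 by exact: (Ex_centered (sz 0%N)).
have Ea j : Ex P (fun w => a 0%N w j 0) = 0.
  exact: (Ex_projection_error (sz 0%N) seta eta_mean).
have Eza k j : Ex P (fun w => zc k 0%N w * a 0%N w j 0) = 0.
  exact: (projection_error_uncorrelated (sz 0%N) seta eta_mean Vunit).
(* The conditional mean condition, integrated over the whole space. *)
have Eeps t : Ex P (fun w => eps 0%N w t 0) = 0.
  have [_ _ _ /(_ setT)] := Ceps 0%N t.
  rewrite preimage_setT => H; rewrite Ex_integral H ?integral0 //.
  exact: (@measurableT _ (@borelT R _)).
have Ezeps0 k t : Ex P (fun w => zc k 0%N w * eps 0%N w t 0) = 0.
  have ie : intg P (fun w => eps 0%N w t 0) by exact: sqintg_intg.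
  have ize : intg P (fun w => z 0%N w k 0 * eps 0%N w t 0) by exact: sqintgM.
  under eq_fun do rewrite /zc mulrBl -mulNr.
  rewrite ExD ?ExZ ?Eeps //; last exact: intgZ.
  by rewrite mulr0 addr0 /Ex Ezeps.
have Eu t : Ex P (u t 0%N) = 0.
  have ia j : intg P (fun w => a 0%N w j 0) by exact: sqintg_intg.
  rewrite (funext (uE t 0%N)).
  rewrite ExD ?Ex_sum ?Eeps ?addr0 //.
  - by rewrite big1 // => j _; rewrite ExZ // Ea mulr0.
  - by move=> j; exact: intgZ.
  - by apply: intg_sum => j; exact: intgZ.
  - exact: sqintg_intg.
have Ezu k t : Ex P (fun w => zc k 0%N w * u t 0%N w) = 0.
  have iza j : intg P (fun w => zc k 0%N w * a 0%N w j 0) by exact: sqintgM.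
  under eq_fun => w.
    rewrite uE mulrDr mulr_sumr.
    under eq_bigr => j _ do rewrite mulrCA.
    over.
  rewrite ExD ?Ex_sum ?Ezeps0 ?addr0 //.
  - by rewrite big1 // => j _; rewrite ExZ // Eza mulr0.
  - by move=> j; exact: intgZ.
  - by apply: intg_sum => j; exact: intgZ.
  - exact: sqintgM.
have EV k l : Ex P (fun w => zc k 0%N w * zc l 0%N w) = V k l.
  rewrite /V mxE covariance_Ex; congr Ex; apply/funext => w.
  by rewrite /zc /mu !mxE.

(* Limits in probability of the sample moments *)
have wl0 (Y : nat -> Omega -> R) : pairwise_iid P Y -> (forall i, sqintg P (Y i)) ->
    Ex P (Y 0%N) = 0 -> smallp P (fun n w => n%:R^-1 * \sum_(i < n) Y i w).
  move=> pY sY Y0; apply: smallp_le (weak_law pY _) _ => [i|n w _].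
    exact: sqintg_intg.
  by rewrite Y0 subr0.
have zz_small k l : smallp P (fun n w =>
    scov n (fun i => zc k i w) (fun i => zc l i w) - V k l).
  apply: smallp_scov; [|exact: wl0|exact: wl0].
  rewrite -EV; apply: (@weak_law _ _ _ P (fun i w => zc k i w * zc l i w)) => //.
  by move=> i; exact: sqintgM.
have zu_small (tk : 'I_(q + r) * 'I_m) : smallp P (fun n w =>
    scov n (fun i => zc tk.2 i w) (fun i => u tk.1 i w)).
  have : smallp P (fun n w =>
      scov n (fun i => zc tk.2 i w) (fun i => u tk.1 i w) - 0).
    apply: smallp_scov; [|exact: wl0|exact: wl0].
    have izu i : intg P (fun w => zc tk.2 i w * u tk.1 i w) by exact: sqintgM.
    have := weak_law (pzu tk.2 tk.1) izu.
    by under [X in smallp P X -> _]eq_fun => n do under eq_fun => w do rewrite Ezu.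
  by move=> h; apply: smallp_le h _ => n w _; rewrite subr0.
(* the part of x_it that is not a function of z_i is deterministic, but it may
   vary with i *)
pose c t j i := Emx P (fun w' => (row t (X i w'))^T) j 0 -
  \sum_k Sm t k j * (Emx P (z i) k 0 - mu k).
have [N0 [mN0 PN0 N0P]] := spans_regressors_off_null span.
(* Recentering from the mean of [z i] to the common [mu] is a deterministic shift, absorbed by
   [c]. *)
have XE w : ~ N0 w -> forall i t j,
    X i w t j = c t j i + \sum_k Sm t k j * (z i w k 0 - mu k).
  move=> /N0P H i t j.
  have := congr1 (fun M : 'cV[R]_K => M j 0) (H i t).
  have subE (f g : 'cV[R]_K) : (f - g) j 0 = f j 0 - g j 0 by rewrite !mxE.
  rewrite subE [(row t (X i w))^T j 0]mxE [row _ _ _ _]mxE.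
  have trE (A : 'M[R]_(m, K)) f g : (A^T *m (f - g)) j 0 =
      \sum_k A k j * (f k 0 - mu k) - \sum_k A k j * (g k 0 - mu k).
    rewrite mxE -sumrB; apply: eq_bigr => k _; rewrite !mxE; ring.
  rewrite trE => /eqP; rewrite subr_eq => /eqP ->; rewrite /c; ring.
(* As [c] is deterministic, so is the frame; inner products with it are weighted sums of i.i.d.
   variables with weights depending on [n]. *)
have /choice[ o oP] : forall nt : nat * 'I_(q + r), exists o,
    dominating_frame nt.1 (fun j i => c nt.2 j i - mean nt.1 (c nt.2 j)) o.
  by move=> nt; exact: dominating_frame_exists.
have oz_small (tlk : 'I_(q + r) * 'I_K * 'I_m) : smallp P (fun n w =>
    n%:R^-1 * (\sum_(i < n) o (n, tlk.1.1) tlk.1.2 i * zc tlk.2 i w) ^+ 2).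
  apply: (@smallp_weighted_sum2 _ _ _ P _ (fun n => o (n, tlk.1.1) tlk.1.2)) => //.
  by move=> n; have [+ _] := oP (n, tlk.1.1); apply.
have ou_small (tl : 'I_(q + r) * 'I_K) : smallp P (fun n w =>
    n%:R^-1 * (\sum_(i < n) o (n, tl.1) tl.2 i * u tl.1 i w) ^+ 2).
  apply: (@smallp_weighted_sum2 _ _ _ P _ (fun n => o (n, tl.1) tl.2)) => //.
  by move=> n; have [+ _] := oP (n, tl.1); apply.
(* The sum of all absolute deviations dominates each of them, so a single exceptional event serves
   every period and coordinate. *)
have rho_small := smallpD
  (smallpD (smallp_sum_norm (fun kl : 'I_m * 'I_m => zz_small kl.1 kl.2))
           (smallp_sum_norm zu_small))
  (smallpD (smallp_sum_norm oz_small) (smallp_sum_norm ou_small)).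

(* Identification through the quadratic form [F] *)
pose b t psi k := pi_t Sm t psi0 k 0 - pi_t Sm t psi k 0.
have cb t k : continuous (fun psi => b t psi k).
  by apply: continuous_sub; [exact: continuous_const|exact: continuous_pi].
have [B B0 bB] := @compact_family_bound R _ ('I_(q + r) * 'I_m)%type Psibar
  (fun tk psi => b tk.1 psi tk.2) cpt (fun tk => cb tk.1 tk.2).
pose F psi := \sum_t \sum_k \sum_l b t psi k * b t psi l * V k l.
have cF : continuous F.
  apply: continuous_sum => t; apply: continuous_sum => k.
  apply: continuous_sum => l; apply: continuous_mul; last exact: continuous_const.
  by apply: continuous_mul; exact: cb.
have bVb t psi : \sum_k \sum_l b t psi k * b t psi l * V k l =
    ((pi_t Sm t psi0 - pi_t Sm t psi)^T *m Var P (z 0%N) *m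
     (pi_t Sm t psi0 - pi_t Sm t psi)) 0 0.
  rewrite quadratic_formE; apply: eq_bigr => k _; apply: eq_bigr => l _.
  have subE (f g : 'cV[R]_m) k' : (f - g) k' 0 = f k' 0 - g k' 0 by rewrite !mxE.
  by rewrite !subE.
(* (A5) provides a period with a nonzero difference, where (A4) makes the form positive; the other
   periods contribute nonnegative terms. *)
have F0 psi : Psi psi -> psi <> psi0 -> 0 < F psi.
  move=> Ppsi /(ident _ Ppsi)[t pit].
  have bt0 : pi_t Sm t psi0 - pi_t Sm t psi != 0.
    by rewrite subr_eq0; apply/eqP => E; apply: pit.
  have Q0 t' : 0 <= \sum_k \sum_l b t' psi k * b t' psi l * V k l.
    rewrite bVb; have [->|b0] := eqVneq (pi_t Sm t' psi0 - pi_t Sm t' psi) 0.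
      by rewrite mulmx0 mxE.
    by apply: ltW; exact: pdV.2.
  rewrite /F (bigD1 t) //=; apply: ltr_wpDr; last by rewrite bVb; exact: pdV.2.
  by apply: sumr_ge0 => t' _.
have /choice[psihat hatP] : forall n, exists h : Omega -> _, random_mx h /\
    forall w, Psibar (h w) /\ ((0 < n)%N ->
      forall psi, Psibar psi -> Sn n w (h w) <= Sn n w psi).
  (* At [n = 0] the constant [psi0] is a default value; minimality is asserted for positive [n]
     only. *)
  case=> [|n]; first by exists (fun=> psi0); split => //; exact: random_mx_cst.
  have [h [mh hP]] := @measurable_minimizer _ _ R _ (Sn n.+1) Psibar
    (ex_intro _ psi0 psi0in) cpt (fun w => @continuous_nls R K m q r n.+1 _ _ _ (ltn0Sn n))
    (fun psi => measurable_nls psi (ltn0Sn n) my mX mz).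
  by exists h; split => // w; have [? ?] := hP w; split.
exists psihat; split.
  move=> n n0; have [mh hP] := hatP n; split => // w.
  by have [? h] := hP w; split => //; exact: h.

(* Convergence of the minimizers in probability *)
move=> e e0.
pose dist2 (psi : 'cV[R]_(K + (q * m + q * r))) := \sum_i (psi i 0 - psi0 i 0) ^+ 2.
have far psi : (e < enorm (psi - psi0)) = (e ^+ 2 < dist2 psi).
  rewrite /enorm (_ : \sum_i _ = dist2 psi); last first.
    by apply: eq_bigr => i _; congr (_ ^+ 2); rewrite !mxE.
  rewrite -ltr_sqr ?nnegrE ?sqrtr_ge0 ?ltW // sqr_sqrtr //.
  by apply: sumr_ge0 => i _; exact: sqr_ge0.
have cdist2 : continuous dist2.
  apply: continuous_sum => i; under eq_fun do rewrite expr2.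
  by apply: continuous_mul; apply: continuous_sub;
    (exact: coord_continuous || exact: continuous_const).
(* [kappa0] bounds [F] below on the compact part of [Psibar] at distance at least [e] from
   [psi0]. *)
have [kappa0 kappa0_gt0 Fkappa0] : exists2 kappa0, 0 < kappa0 &
    forall psi, Psibar psi -> e ^+ 2 <= dist2 psi -> kappa0 <= F psi.
  have cD : compact (Psibar `&` [set psi | - dist2 psi <= - e ^+ 2]).
    apply: compact_closedI => //; apply: closed_sublevel => psi.
    exact: (continuousN (cdist2 psi)).
  have [|k0 k00 k0P] := compact_positive_min cD cF.
    move=> psi [/= Ppsi]; rewrite lerN2 => epsi; apply: F0; first exact: sub.
    move=> E; move: epsi; rewrite E /dist2 big1 => [|i _]; last first.
      by rewrite subrr expr0n.
    by rewrite leNgt exprn_gt0.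
  by exists k0 => // psi Ppsi epsi; apply: k0P; split => //=; rewrite lerN2.
have mbad n : measurable [set w | e < enorm (psihat n w - psi0)].
  have [mh _] := hatP n.
  have md : measurable_fun [set: Omega] (fun w => dist2 (psihat n w)).
    apply: measurable_sum => i; apply: measurable_funX.
    by apply: (measurable_funB (mh i 0)); exact: measurable_cst.
  rewrite -[X in measurable X]setTI.
  rewrite (_ : [set w | _] = (fun w => dist2 (psihat n w)) @^-1` `]e ^+ 2, +oo[).
    exact: md.
  by apply/seteqP; split => w /=; rewrite far in_itv /= andbT.
apply: probability_cvg0 => // delta delta0'.
pose kappa := m%:R ^+ 2 * B ^+ 2 + 2 * m%:R * B +
  K%:R * (2 * m%:R ^+ 2 * B ^+ 2 + 2).
have kappa_ge0 : 0 <= kappa.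
  by rewrite !(addr_ge0, mulr_ge0, exprn_ge0).
(* Chosen so that the errors of all [q + r] periods, [kappa * rho] each, sum to less than [kappa0];
   the added 1 keeps the denominator positive. *)
pose rho := kappa0 / ((q + r)%:R * kappa + 1).
have den0 : 0 < (q + r)%:R * kappa + 1 by rewrite ltr_wpDl // mulr_ge0.
have rho0 : 0 < rho by rewrite divr_gt0.
have [N NP] := rho_small rho delta rho0 delta0'.
exists (maxn N 1) => n; rewrite geq_max => /andP[/NP[A [mA PA Arho]] n0].
have [mh hP] := hatP n.
(* Off the exceptional event and the null set, a minimizer farther than [e] from [psi0] would
   contradict the lower bound [kappa0]. *)
suff sub_bad : [set w | e < enorm (psihat n w - psi0)] `<=` A `|` N0.
  apply: (@le_trans _ _ (P (A `|` N0))); last first.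
    have PN : (P N0 <= 0)%E by rewrite PN0.
    rewrite -[delta%:E]adde0; apply: le_trans (leeD PA PN).
    exact: measureU2.
  by apply: le_measure; rewrite ?inE //; exact: measurableU.
move=> w /=; rewrite far => ew; apply/not_notP => /not_orP[Aw N0w].
have {}Arho := le_trans (ler_norm _) (Arho w Aw).
have [Phat hmin] := hP w.
have := Fkappa0 _ Phat (ltW ew); apply/negP; rewrite -ltNge.
set psi := psihat n w in Phat hmin *.
set s1 := \sum_i `|_| in Arho; set s2 := \sum_i `|_| in Arho.
set s3 := \sum_i `|_| in Arho; set s4 := \sum_i `|_| in Arho.
have [s10 s20 s30 s40] : [/\ 0 <= s1, 0 <= s2, 0 <= s3 & 0 <= s4].
  by split; apply: sumr_ge0 => ? _.
have key t : \sum_k \sum_l b t psi k * b t psi l * V k l <=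
    scov n (resid (y^~ w) (X^~ w) (z^~ w) psi t) (resid (y^~ w) (X^~ w) (z^~ w) psi t) -
    scov n (resid (y^~ w) (X^~ w) (z^~ w) psi0 t) (resid (y^~ w) (X^~ w) (z^~ w) psi0 t) +
    kappa * rho.
  pose d0 := delta0 t 0 + (L0 *m mu0) t 0.
  have r0E i : resid (y^~ w) (X^~ w) (z^~ w) psi0 t i = d0 + u t i w.
    exact: (@resid_at_truth R K m q r (y^~ w) (X^~ w) (z^~ w) beta0 delta0
      (eps i w) Phi0 Theta0 mu0 (etat i w) t i uPhi erefl).
  have uu : scov n (resid (y^~ w) (X^~ w) (z^~ w) psi0 t)
      (resid (y^~ w) (X^~ w) (z^~ w) psi0 t) = scov n (u t ^~ w) (u t ^~ w).
    rewrite (eq_scov n r0E r0E) scovDl scov_cstl // add0r scovC scovDl.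
    by rewrite scov_cstl // add0r.
  rewrite uu.
  (* [gamma] and [a] are read off [resid_decomposition]; [a] gathers all terms constant in [i]. *)
  apply: (residual_variance_bound (c := c t) (zc := fun k i => zc k i w) (u := u t ^~ w)
     (gamma := fun j => beta_of psi0 j 0 - beta_of psi j 0)
     (a := \sum_k (Theta_row psi0 t k 0 - Theta_row psi t k 0) * mu k + d0)
     n0 (oP (n, t)) B0 (ltW rho0)).
  - move=> k l; apply: le_trans Arho.
    have := le_sum_norm (fun kl : 'I_m * 'I_m =>
      scov n (fun i => zc kl.1 i w) (fun i => zc kl.2 i w) - V kl.1 kl.2) (k, l).
    rewrite -/s1 /=; lra.
  - move=> k; apply: le_trans Arho.
    have := le_sum_norm (fun tk : 'I_(q + r) * 'I_m =>
      scov n (fun i => zc tk.2 i w) (fun i => u tk.1 i w)) (t, k).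
    rewrite -/s2 /=; lra.
  - move=> l k; apply: le_trans (ler_norm _) _; apply: le_trans Arho.
    have := le_sum_norm (fun tlk : 'I_(q + r) * 'I_K * 'I_m =>
      n%:R^-1 * (\sum_(i < n) o (n, tlk.1.1) tlk.1.2 i * zc tlk.2 i w) ^+ 2) (t, l, k).
    rewrite -/s3 /=; lra.
  - move=> l; apply: le_trans (ler_norm _) _; apply: le_trans Arho.
    have := le_sum_norm (fun tl : 'I_(q + r) * 'I_K =>
      n%:R^-1 * (\sum_(i < n) o (n, tl.1) tl.2 i * u tl.1 i w) ^+ 2) (t, l).
    rewrite -/s4 /=; lra.
  - by move=> k; exact: (bB (t, k) psi Phat).
  - move=> i; rewrite (resid_decomposition (y^~ w) psi psi0 (XE w N0w i t)) r0E.
    by congr (_ + _); exact: addrA.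
(* Comparison with [psi0] makes the summed variance differences nonpositive, so [F psi] is at most
   the total error, which is below [kappa0]. *)
have := hmin n0 psi0 psi0in; rewrite /Sn !nlsE // ler_pM2l ?invr_gt0 // => le0.
apply: (@le_lt_trans _ _ ((q + r)%:R * kappa * rho)).
  apply: (@le_trans _ _ (\sum_t (scov n (resid (y^~ w) (X^~ w) (z^~ w) psi t)
      (resid (y^~ w) (X^~ w) (z^~ w) psi t) -
    scov n (resid (y^~ w) (X^~ w) (z^~ w) psi0 t)
      (resid (y^~ w) (X^~ w) (z^~ w) psi0 t) + kappa * rho))).
    by apply: ler_sum => t _; exact: key.
  rewrite big_split /= sumrB sumr_const card_ord -[_ *+ (q + r)]mulr_natl mulrA.
  by rewrite gerDr subr_le0.
rewrite /rho mulrA ltr_pdivrMr // mulrC ltr_pM2l // ltrDl //.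
Qed.
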